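(* Let $R$ be a ring that is not von Neumann regular. Suppose that $R$ is left Noetherian and left nonsingular and that every pure-injective left $R$-module is injective or pi-indigent. Then every non-flat left $R$-module is i-test. In particular, $R$ is a left n-saturated ring.
   Context: Rings are associative with identity. A module $M$ is called $N$-subinjective (for $N$ a module on the same side) if for every module $K$ containing $N$ as a submodule, every homomorphism $N\to M$ extends to a homomorphism $K\to M$. The subinjectivity domain of $M$ is $\underline{\mathfrak{In}}^{-1}(M)=\{N : M \text{ is } N\text{-subinjective}\}$. A module $N$ is absolutely pure (fp-injective) if every short exact sequence $0\to N\to B\to C\to 0$ is pure exact. A pure-injective module $M$ is called pi-indigent if $\underline{\mathfrak{In}}^{-1}(M)$ is exactly the class of absolutely pure modules (on the same side as $M$). A module $M$ is i-test (a Whitehead test module for injectivity) if every module $N$ with $\mathrm{Ext}^1_R(M,N)=0$ is injective. A non-semisimple ring $R$ is left n-saturated if every non-projective finitely generated left $R$-module is i-test. *)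

(* Defs.v *)
From HB Require Import structures.
From mathcomp Require Import all_boot all_algebra.
From mathcomp Require Import boolp.
From mathcomp Require Import freeg.

Set Implicit Arguments.
Unset Strict Implicit.
Unset Printing Implicit Defensive.

Import GRing.Theory.
Local Open Scope ring_scope.
Local Open Scope quotient_scope.

(* A left R-module is an [lmodType R]; a right R-module is an [lmodType R^c],
   where [(r : R^c) *: x] is the product written x r on paper.
   Classical reasoning ([boolp]) is assumed, so that the boolean predicates
   [{pred V}] are all the subsets of V. *)

(* X (x)_R A is the free abelian group on the set X * A modulo the subgroup
   generated by the usual bilinearity and balancing relations. *)

Section Tensor.
Variables (R : pzRingType) (X : lmodType R^c) (A : lmodType R).

Variant tensor_relator : {freeg (X * A) / int} -> Prop :=
| TensorAddl x x' a :
    tensor_relator (<< (x + x', a) >> - << (x, a) >> - << (x', a) >>)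
| TensorAddr x a a' :
    tensor_relator (<< (x, a + a') >> - << (x, a) >> - << (x, a') >>)
| TensorBal x (r : R) a :
    tensor_relator (<< ((r : R^c) *: x, a) >> - << (x, r *: a) >>).

Definition tensor_null : {pred {freeg (X * A) / int}} := fun t =>
  `[< forall S : {pred {freeg (X * A) / int}}, zmod_closed S ->
      (forall s, tensor_relator s -> s \in S) -> t \in S >].

Lemma tensor_null_zmod_closed : zmod_closed tensor_null.
Proof.
split; first by apply/asboolP => S [].
move=> s t /asboolP hs /asboolP ht; apply/asboolP => S cS rS.
by case: (cS) => _; apply; [apply: hs | apply: ht].
Qed.

HB.instance Definition _ := GRing.isZmodClosed.Build {freeg (X * A) / int}
  tensor_null tensor_null_zmod_closed.

Definition tensor : Type := Quotient.quot tensor_null.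
HB.instance Definition _ := Choice.on tensor.
HB.instance Definition _ := GRing.Zmodule.on tensor.
HB.instance Definition _ := EqQuotient.on tensor.
HB.instance Definition _ := ZmodQuotient.on tensor.

Definition tens (x : X) (a : A) : tensor := \pi_tensor << (x, a) >>.

Lemma tensor_piP s t :
  reflect (\pi_tensor s = \pi_tensor t) (s - t \in tensor_null).
Proof. by rewrite Quotient.idealrBE; apply: eqP. Qed.

Lemma tens_pi_is_zmod_morphism : zmod_morphism \pi_tensor.
Proof. exact: pi_is_zmod_morphism. Qed.

Lemma tensDl x x' a : tens (x + x') a = tens x a + tens x' a.
Proof.
apply/eqP; rewrite -subr_eq0 opprD addrA -!tens_pi_is_zmod_morphism.
rewrite -(subrr (\pi_tensor 0)) -tens_pi_is_zmod_morphism subrr.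
apply/eqP/tensor_piP; rewrite subr0; apply/asboolP => S _; apply.
exact: TensorAddl.
Qed.

Lemma tensDr x a a' : tens x (a + a') = tens x a + tens x a'.
Proof.
apply/eqP; rewrite -subr_eq0 opprD addrA -!tens_pi_is_zmod_morphism.
rewrite -(subrr (\pi_tensor 0)) -tens_pi_is_zmod_morphism subrr.
apply/eqP/tensor_piP; rewrite subr0; apply/asboolP => S _; apply.
exact: TensorAddr.
Qed.

Lemma tens_bal x (r : R) a : tens ((r : R^c) *: x) a = tens x (r *: a).
Proof. by apply/tensor_piP/asboolP => S _; apply; exact: TensorBal. Qed.

End Tensor.

Section TensorMap.
Variables (R : pzRingType) (X Y : lmodType R^c) (A B : lmodType R).

Definition tensor_free_map (f : X -> Y) (g : A -> B) :
    {freeg (X * A) / int} -> {freeg (Y * B) / int} :=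
  fglift (fun p => << (f p.1, g p.2) >>).

(* f (x) g, sending x (x) a to f x (x) g a; it is well defined for linear f
   and g, see [tensor_mapE] and [tensor_map_is_zmod_morphism]. *)
Definition tensor_map (f : X -> Y) (g : A -> B) (t : tensor X A) : tensor Y B :=
  \pi_(tensor Y B) (tensor_free_map f g (repr t)).

Lemma tensor_free_mapB f g s t :
  tensor_free_map f g (s - t) = tensor_free_map f g s - tensor_free_map f g t.
Proof. exact: lift_is_additive. Qed.

Lemma tensor_free_mapU f g x a :
  tensor_free_map f g << (x, a) >> = << (f x, g a) >>.
Proof. by rewrite /tensor_free_map liftU scale1r. Qed.

Variables (f : {linear X -> Y}) (g : {linear A -> B}).

Lemma tensor_free_map_null t :
  t \in @tensor_null R X A -> tensor_free_map f g t \in @tensor_null R Y B.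
Proof.
move=> /asboolP /(_ [pred t | tensor_free_map f g t \in @tensor_null R Y B]).
apply.
  split=> [|s u]; rewrite !inE; last by rewrite tensor_free_mapB; apply: rpredB.
  by rewrite -(subrr 0) tensor_free_mapB subrr rpred0.
move=> s rs; rewrite inE; apply/asboolP => S _ hS.
have mapE := (tensor_free_mapB f g, tensor_free_mapU f g).
case: rs => [x x' a|x a a'|x r a]; rewrite !mapE.
- by rewrite (linearD f); apply: hS; exact: TensorAddl.
- by rewrite (linearD g); apply: hS; exact: TensorAddr.
- by rewrite (linearZZ f) (linearZZ g); apply: hS; exact: TensorBal.
Qed.

Lemma tensor_map_pi t :
  tensor_map f g (\pi_(tensor X A) t) = \pi_(tensor Y B) (tensor_free_map f g t).
Proof.
apply/tensor_piP; rewrite -tensor_free_mapB tensor_free_map_null //.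
by apply/tensor_piP; rewrite reprK.
Qed.

Lemma tensor_mapE x a : tensor_map f g (tens x a) = tens (f x) (g a).
Proof. by rewrite tensor_map_pi tensor_free_mapU. Qed.

Lemma tensor_map_is_zmod_morphism : zmod_morphism (tensor_map f g).
Proof.
move=> s t; rewrite -[s]reprK -[t]reprK -tens_pi_is_zmod_morphism.
by rewrite !tensor_map_pi tensor_free_mapB tens_pi_is_zmod_morphism.
Qed.

End TensorMap.

(* 0 -> A -> B -> C -> 0 is exact at the level of abelian groups; also used
   for R-linear maps. *)
Definition short_exact (A B C : zmodType) (f : A -> B) (g : B -> C) : Prop :=
  [/\ injective f,
      forall b, g b = 0 <-> exists a, f a = b &
      forall c, exists b, g b = c].

Definition pure_exact (R : pzRingType) (A B C : lmodType R)
    (f : {linear A -> B}) (g : {linear B -> C}) : Prop :=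
  short_exact f g /\
  forall X : lmodType R^c,
    short_exact (tensor_map (@idfun X) f) (tensor_map (@idfun X) g).

Definition flat (R : pzRingType) (M : lmodType R) : Prop :=
  forall (A B C : lmodType R^c) (f : {linear A -> B}) (g : {linear B -> C}),
    short_exact f g ->
    short_exact (tensor_map f (@idfun M)) (tensor_map g (@idfun M)).

Definition absolutely_pure (R : pzRingType) (N : lmodType R) : Prop :=
  forall (B C : lmodType R) (f : {linear N -> B}) (g : {linear B -> C}),
    short_exact f g -> pure_exact f g.

Definition injective_module (R : pzRingType) (M : lmodType R) : Prop :=
  forall (A B : lmodType R) (i : {linear A -> B}) (f : {linear A -> M}),
    injective i -> exists h : {linear B -> M}, forall a, h (i a) = f a.

Definition projective_module (R : pzRingType) (M : lmodType R) : Prop :=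
  forall (A B : lmodType R) (p : {linear A -> B}) (f : {linear M -> B}),
    (forall b, exists a, p a = b) ->
    exists h : {linear M -> A}, forall m, p (h m) = f m.

Definition pure_injective (R : pzRingType) (M : lmodType R) : Prop :=
  forall (A B C : lmodType R) (i : {linear A -> B}) (p : {linear B -> C})
    (f : {linear A -> M}),
    pure_exact i p -> exists h : {linear B -> M}, forall a, h (i a) = f a.

(* M is N-subinjective; the containment of N in K is an injective linear map. *)
Definition subinjective (R : pzRingType) (M N : lmodType R) : Prop :=
  forall (K : lmodType R) (i : {linear N -> K}) (f : {linear N -> M}),
    injective i -> exists h : {linear K -> M}, forall x, h (i x) = f x.

Definition pi_indigent (R : pzRingType) (M : lmodType R) : Prop :=
  pure_injective M /\
  forall N : lmodType R, subinjective M N <-> absolutely_pure N.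

Definition extension_equiv (R : pzRingType) (N M E E' : lmodType R)
    (f : N -> E) (g : E -> M) (f' : N -> E') (g' : E' -> M) : Prop :=
  exists phi : {linear E -> E'},
    [/\ bijective phi, forall x, phi (f x) = f' x & forall e, g' (phi e) = g e].

(* Ext^1_R(M, N) is the group, under Baer sum, of equivalence classes of
   extensions 0 -> N -> E -> M -> 0.  Its zero is the class of the split
   extension 0 -> N -> N (+) M -> M -> 0, so the group vanishes when every
   extension lies in that class. *)
Definition Ext1_eq0 (R : pzRingType) (M N : lmodType R) : Prop :=
  forall (E : lmodType R) (f : {linear N -> E}) (g : {linear E -> M}),
    short_exact f g ->
    extension_equiv f g (fun x : N => (x, 0) : (N * M)%type)
                        (fun y : (N * M)%type => y.2).

Definition i_test (R : pzRingType) (M : lmodType R) : Prop :=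
  forall N : lmodType R, Ext1_eq0 M N -> injective_module N.

(* Submodules of V are the [S : {pred V}] with [GRing.submod_closed S]; left
   ideals of R are the submodules of the regular left module [R^o]. *)

Definition von_neumann_regular (R : pzRingType) : Prop :=
  forall a : R, exists b : R, a * b * a = a.

Definition noetherian_module (R : pzRingType) (M : lmodType R) : Prop :=
  forall I : nat -> {pred M},
    (forall n, GRing.submod_closed (I n)) ->
    (forall n, {subset I n <= I n.+1}) ->
    exists n, forall m, (n <= m)%N -> I m =i I n.

Definition left_noetherian (R : pzRingType) : Prop :=
  noetherian_module (R^o : lmodType R).

Definition essential (R : pzRingType) (M : lmodType R) (S : {pred M}) : Prop :=
  GRing.submod_closed S /\
  forall T : {pred M}, GRing.submod_closed T ->
    (exists2 x, x \in T & x != 0) ->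
    exists x, [/\ x \in S, x \in T & x != 0].

(* m lies in the singular submodule Z(M): its annihilator is an essential left
   ideal. *)
Definition singular_element (R : pzRingType) (M : lmodType R) (m : M) : Prop :=
  @essential R R^o [pred r : R^o | (r : R) *: m == 0].

Definition left_nonsingular (R : pzRingType) : Prop :=
  forall x : R^o, singular_element x -> x = 0.

Definition semisimple_module (R : pzRingType) (M : lmodType R) : Prop :=
  forall S : {pred M}, GRing.submod_closed S ->
    exists T : {pred M},
      [/\ GRing.submod_closed T,
          forall x, x \in S -> x \in T -> x = 0 &
          forall x, exists y z, [/\ y \in S, z \in T & x = y + z]].

Definition semisimple_ring (R : pzRingType) : Prop :=
  semisimple_module (R^o : lmodType R).

Definition finitely_generated (R : pzRingType) (M : lmodType R) : Prop :=
  exists (n : nat) (e : 'I_n -> M), forall m : M,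
    exists a : 'I_n -> R, m = \sum_(i < n) a i *: e i.

Definition left_n_saturated (R : pzRingType) : Prop :=
  ~ semisimple_ring R /\
  forall M : lmodType R,
    finitely_generated M -> ~ projective_module M -> i_test M.

(* Main.v *)
Require Import Defs.
From HB Require Import structures.
From mathcomp Require Import all_boot all_order all_algebra.
From mathcomp Require Import boolp classical_sets functions.
From mathcomp Require Import freeg.

Set Implicit Arguments.
Unset Strict Implicit.
Unset Printing Implicit Defensive.

Import Order.TTheory GRing.Theory Num.Theory.
Local Open Scope classical_set_scope.
Local Open Scope ring_scope.
Local Open Scope quotient_scope.

(** For a right module X let X^+ be the left module of additive maps from X to
    an injective cogenerator D of abelian groups.  A linear map N -> X^+ is a
    balanced map X x N -> D, so X^+ is pure-injective, and X^+ is N-subinjective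
    as soon as X (x) N -> X (x) K is injective for every K containing N.  By
    assumption each X^+ is injective or pi-indigent, and over a left noetherian
    ring absolutely pure modules are injective ([absolutely_pure_injective]).
    Hence: if X^+ is not injective, every N for which X^+ is N-subinjective is
    injective.  This is applied to two kinds of X.

    The first is X = R^+, so that X^+ = R^++.  This module is nonsingular because
    R is left noetherian and nonsingular ([bidual_nonsingular]), and it is not
    injective, because otherwise R would be self-injective, and a nonsingular
    left self-injective ring is von Neumann regular ([bidual_not_injective]).
    A singular module has no nonzero map to R^++, so R^++ is subinjective for
    it: every singular left module is injective ([singular_injective]).

    The second settles finitely generated modules.  Let M = R^n / L be
    nonprojective, where the rows of a matrix A with m rows generate L, and let
    X = R^m / A R^n, the transpose of M.  If X^+ were injective, L would be a
    direct summand of R^n and M projective.  If Ext^1(M, N) = 0 and y = A z with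
    y in N^m and z in K^n, then z induces a map M -> K / N, which lifts to K;
    correcting z by the lift gives a solution in N^n.  So X (x) N -> X (x) K is
    injective, X^+ is N-subinjective, and N is injective
    ([fg_nonprojective_i_test]).

    Finally, a module all of whose finitely generated submodules are projective
    is flat ([flat_of_fg_projective]), so a nonflat M contains a finitely
    generated nonprojective S, which is i-test, and it remains to see that
    Ext^1(M, N) = 0 makes N injective ([i_test_of_submodule]).  As singular
    modules are injective, N is the sum of an injective module and a nonsingular
    one, and N may be taken nonsingular.  Embed N in an injective E; then E / N
    is injective too ([quotient_injective]).  An extension of S by N comes from a
    map S -> E / N; this map extends to M, lifts to E because Ext^1(M, N) = 0,
    and so the extension splits: Ext^1(S, N) = 0. *)

(** * Linear maps, submodules and quotients *)

Section Tools.
Variable R : pzRingType.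
Implicit Types V W A B C M : lmodType R.

Definition linear_of A B (f : A -> B) (h : linear f) : {linear A -> B} :=
  HB.pack f (GRing.isLinear.Build R A B *:%R f h).

Definition additive_of (X Y : zmodType) (f : X -> Y) (h : zmod_morphism f) :
    {additive X -> Y} :=
  HB.pack f (GRing.isZmodMorphism.Build X Y f h).

(** Linear maps are obtained from functional relations throughout, since choice
    functions need not be linear. *)
Lemma linear_of_rel A B (F : A -> B -> Prop) :
    (forall a, exists b, F a b) ->
    (forall a b b', F a b -> F a b' -> b = b') ->
    (forall r a a' b b', F a b -> F a' b' -> F (r *: a + a') (r *: b + b')) ->
  exists f : {linear A -> B}, forall a, F a (f a).
Proof.
move=> tot fct clo; have [f Ff] := choice tot.
have fL : linear f.
  by move=> r a a'; apply: fct (Ff _) _; apply: clo.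
by exists (linear_of fL).
Qed.

Lemma linear_descend A B M (p : {linear A -> B}) (f : {linear A -> M}) :
    (forall b, exists a, p a = b) -> (forall a, p a = 0 -> f a = 0) ->
  exists g : {linear B -> M}, forall a, g (p a) = f a.
Proof.
move=> sp kpf.
have [|b m m' [a pa fa] [a' pa' fa']|r b b' m m' [a pa fa] [a' pa' fa']|g gP] :=
    @linear_of_rel B M (fun b m => exists2 a, p a = b & f a = m).
- by move=> b; have [a pa] := sp b; exists (f a), a.
- apply/eqP; rewrite -fa -fa' -subr_eq0 -linearB; apply/eqP/kpf.
  by rewrite linearB pa pa' subrr.
- by exists (r *: a + a'); rewrite linearP ?pa ?fa ?pa' ?fa'.
exists g => a; have [a' pa' <-] := gP (p a).
apply/eqP; rewrite -subr_eq0 -linearB; apply/eqP/kpf.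
by rewrite linearB pa' subrr.
Qed.

Lemma linear_corestrict A B M (i : {linear A -> B}) (f : {linear M -> B}) :
    injective i -> (forall m, exists a, i a = f m) ->
  exists g : {linear M -> A}, forall m, i (g m) = f m.
Proof.
move=> ii fi; apply: (@linear_of_rel M A (fun m a => i a = f m)) => //.
- by move=> m a a' <- /ii.
- by move=> r m m' a a' ia ia'; rewrite !linearP ia ia'.
Qed.

Definition submodule V (S : set V) : Prop :=
  S 0 /\ forall r u v, S u -> S v -> S (r *: u + v).

Section Submodule.
Variables (V : lmodType R) (S : set V).
Hypothesis subS : submodule S.

Lemma submodule0 : S 0. Proof. by case: subS. Qed.

Lemma submoduleZ r u : S u -> S (r *: u).
Proof. by case: subS => S0 SP Su; rewrite -[_ *: _]addr0; apply: SP. Qed.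

Lemma submoduleD u v : S u -> S v -> S (u + v).
Proof. by case: subS => S0 SP Su Sv; rewrite -[u]scale1r; apply: SP. Qed.

Lemma submoduleN u : S u -> S (- u).
Proof. by rewrite -scaleN1r; apply: submoduleZ. Qed.

Lemma submoduleB u v : S u -> S v -> S (u - v).
Proof. by move=> Su /submoduleN; apply: submoduleD. Qed.

Lemma submodule_sum (I : Type) (s : seq I) (u : I -> V) :
  (forall i, S (u i)) -> S (\sum_(i <- s) u i).
Proof.
move=> Su; elim/big_rec: _ => [|i v _]; first exact: submodule0.
exact: submoduleD.
Qed.

End Submodule.

Lemma submodule_setI V (S T : set V) :
  submodule S -> submodule T -> submodule (fun x => S x /\ T x).
Proof.
move=> [S0 SP] [T0 TP]; split=> // r u v [Su Tu] [Sv Tv].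
by split; [apply: SP | apply: TP].
Qed.

Lemma submodule_add V (S T : set V) :
  submodule S -> submodule T ->
  submodule (fun x => exists s t, [/\ S s, T t & x = s + t]).
Proof.
move=> [S0 SP] [T0 TP]; split; first by exists 0, 0; rewrite addr0.
move=> r _ _ [s [t [Ss Tt ->]]] [s' [t' [Ss' Tt' ->]]].
exists (r *: s + s'), (r *: t + t'); split; [exact: SP|exact: TP|].
by rewrite scalerDr addrACA.
Qed.

Lemma submodule_line V (x : V) : submodule (fun y => exists r, y = r *: x).
Proof.
split; first by exists 0; rewrite scale0r.
by move=> r _ _ [a ->] [b ->]; exists (r * a + b); rewrite scalerDl scalerA.
Qed.

Lemma submodule_preim V W (f : {linear V -> W}) (S : set W) :
  submodule S -> submodule (fun x => S (f x)).
Proof.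
by move=> [S0 SP]; split=> [|r u v]; rewrite ?linear0 ?linearP //; apply: SP.
Qed.

Lemma submodule_im V W (f : {linear V -> W}) (S : set V) :
  submodule S -> submodule (fun y => exists2 x, S x & y = f x).
Proof.
move=> [S0 SP]; split; first by exists 0; rewrite ?linear0.
by move=> r _ _ [u Su ->] [v Sv ->]; exists (r *: u + v); rewrite ?linearP //;
  apply: SP.
Qed.

Lemma submodule_range V W (f : {linear V -> W}) :
  submodule (fun y => exists x, f x = y).
Proof.
split; first by exists 0; rewrite linear0.
by move=> r _ _ [u <-] [v <-]; exists (r *: u + v); rewrite linearP.
Qed.

Lemma submodule_ker V W (f : {linear V -> W}) : submodule (fun x => f x = 0).
Proof.
by split=> [|r u v fu fv]; rewrite ?linear0 // linearP fu fv scaler0 addr0.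
Qed.

End Tools.

Section SubmoduleType.
Variables (R : pzRingType) (V : lmodType R) (S : set V) (subS : submodule S).

Definition submod_mem : {pred V} := fun x => `[< S x >].

Lemma submod_mem_closed : GRing.submod_closed submod_mem.
Proof.
split=> [|r u v /asboolP Su /asboolP Sv]; apply/asboolP.
  exact: submodule0 subS.
by case: subS => _; apply.
Qed.

HB.instance Definition _ :=
  GRing.isSubmodClosed.Build R V submod_mem submod_mem_closed.

Definition submod_type : Type := {x : V | x \in submod_mem}.
HB.instance Definition _ := SubChoice.on submod_type.
HB.instance Definition _ := [SubChoice_isSubLmodule of submod_type by <:].

Lemma submodule_typeP :
  exists (W : lmodType R) (i : {linear W -> V}),
    injective i /\ forall x, S x <-> exists w, i w = x.
Proof.
exists submod_type, val; split; first exact: val_inj.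
move=> x; split=> [Sx|[[w /asboolP Sw] <-]] //.
by exists (exist _ x (asboolT Sx)).
Qed.

Definition quot_type : Type := Quotient.quot submod_mem.
HB.instance Definition _ := Choice.on quot_type.
HB.instance Definition _ := GRing.Zmodule.on quot_type.
HB.instance Definition _ := EqQuotient.on quot_type.
HB.instance Definition _ := ZmodQuotient.on quot_type.

Lemma quot_typeP x y : \pi_quot_type x = \pi_quot_type y <-> S (x - y).
Proof.
split; first by move/eqP; rewrite -Quotient.idealrBE => /asboolP.
by move=> Sxy; apply/eqP; rewrite -Quotient.idealrBE; apply/asboolP.
Qed.

Lemma pi_zmod_morphism : zmod_morphism \pi_quot_type.
Proof. exact: pi_is_zmod_morphism. Qed.

Definition quot_scale (r : R) (x : quot_type) : quot_type :=
  \pi_quot_type (r *: repr x).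

Lemma quot_scale_pi r x :
  quot_scale r (\pi_quot_type x) = \pi_quot_type (r *: x).
Proof.
apply/quot_typeP; rewrite -scalerBr; apply: (submoduleZ subS).
by apply/quot_typeP; rewrite reprK.
Qed.

Lemma pi_addE x y :
  \pi_quot_type (x + y) = \pi_quot_type x + \pi_quot_type y.
Proof. exact: (raddfD (additive_of pi_zmod_morphism)). Qed.

Fact quot_scalerA r s x : quot_scale r (quot_scale s x) = quot_scale (r * s) x.
Proof.
by rewrite -[x]reprK (quot_scale_pi s) (quot_scale_pi (r * s)) quot_scale_pi
           scalerA.
Qed.
Fact quot_scale1r : left_id 1 quot_scale.
Proof. by move=> x; rewrite -[x]reprK quot_scale_pi scale1r. Qed.
Fact quot_scalerDr : right_distributive quot_scale +%R.
Proof.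
move=> r x y; rewrite -[x]reprK -[y]reprK -pi_addE.
by rewrite quot_scale_pi scalerDr pi_addE -2!quot_scale_pi.
Qed.
Fact quot_scalerDl x : {morph quot_scale^~ x : r s / r + s}.
Proof.
move=> r s; rewrite -[x]reprK quot_scale_pi scalerDl pi_addE.
by rewrite -2!quot_scale_pi.
Qed.

HB.instance Definition _ := GRing.Zmodule_isLmodule.Build R quot_type
  quot_scalerA quot_scale1r quot_scalerDr quot_scalerDl.

Lemma quotient_moduleP :
  exists (W : lmodType R) (p : {linear V -> W}),
    (forall w, exists x, p x = w) /\ forall x, p x = 0 <-> S x.
Proof.
have pL : linear \pi_quot_type.
  by move=> r x y; rewrite pi_addE; congr (_ + _); rewrite -quot_scale_pi.
exists quot_type, (linear_of pL); split=> [w|x].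
  by exists (repr w); exact: reprK.
rewrite -(linear0 (linear_of pL)) /=.
split=> [/quot_typeP|]; first by rewrite subr0.
by move=> Sx; apply/quot_typeP; rewrite subr0.
Qed.
End SubmoduleType.

Lemma cokernelP (R : pzRingType) (A B : lmodType R) (f : {linear A -> B}) :
  exists (C : lmodType R) (q : {linear B -> C}),
    (forall c, exists b, q b = c) /\
    forall b, q b = 0 <-> exists a, f a = b.
Proof. exact: quotient_moduleP (submodule_range f). Qed.

(** * Essential submodules, singular elements and injectivity *)

Section Essential.
Variable R : pzRingType.
Implicit Types V W A B C M : lmodType R.

(** Both Baer's criterion and the existence of complements are instances of this
    use of Zorn's lemma: a partial linear map is a submodule of a product that
    meets the second factor trivially.  Maximality is stated on elements: adding
    any new x to S creates a nonzero element of N. *)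
Lemma maximal_disjoint V (N S0 : set V) :
    submodule N -> submodule S0 -> (forall x, S0 x -> N x -> x = 0) ->
  exists S : set V,
    [/\ submodule S, forall x, S0 x -> S x, forall x, S x -> N x -> x = 0 &
        forall x, ~ S x ->
          exists r s, [/\ S s, N (s + r *: x) & s + r *: x != 0]].
Proof.
move=> subN subS0 dis0.
(* Adjoining S0 makes the empty chain harmless. *)
pose P (S : set V) :=
  submodule (S `|` S0) /\ forall x, (S `|` S0) x -> N x -> x = 0.
have [F FP totF|S [[subS disS] maxS]] := @Zorn_bigcup V P.
  have [[X0 FX0]|noF] := pselect (exists X, F X); last first.
    have -> : \bigcup_(X in F) X = set0.
      by rewrite bigcup0// => X FX; case: noF; exists X.
    by rewrite /P set0U.
  split=> [|x [[X FX Xx]|S0x]]; last 2 first.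
  - by apply: (FP X FX).2; left.
  - exact: dis0.
  split; first by right; apply: submodule0 subS0.
  have mem x : (\bigcup_(X in F) X `|` S0) x ->
      exists2 X, F X & (X `|` S0) x.
    by case=> [[X FX Xx]|S0x]; [exists X; [|left]|exists X0; [|right]].
  have join X Y Z : X `<=` Y -> (X `|` Z) `<=` (Y `|` Z).
    by move=> XY x [/XY|]; [left|right].
  move=> r u v /mem[X FX Xu] /mem[Y FY Yv].
  have [Z FZ Zuv] : exists2 Z, F Z & (Z `|` S0) (r *: u + v).
    have [XY|YX] := totF _ _ FX FY.
      by exists Y => //; apply: (FP Y FY).1.2 => //; apply: join Xu.
    by exists X => //; apply: (FP X FX).1.2 => //; apply: join Yv.
  by case: Zuv => [Zuv|]; [left; exists Z|right].
exists (S `|` S0); split=> // [x|x nSx]; first by right.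
apply: contrapT => none.
pose T := (fun y =>
  exists s t, [/\ (S `|` S0) s, exists r, t = r *: x & y = s + t]).
have subT : submodule T by apply: submodule_add subS (submodule_line x).
have S_T y : (S `|` S0) y -> T y.
  by move=> Sy; exists y, 0; split; rewrite ?addr0 //; exists 0; rewrite scale0r.
have TU : (T `|` S0) = T.
  by apply/seteqP; split=> y; [case=> // S0y; apply: S_T; right | left].
apply: (maxS T).
  split; first by move=> y Sy; apply: S_T; left.
  move=> /(_ x) TS; apply: nSx; left; apply: TS.
  exists 0, x; rewrite add0r; split=> //; first exact: submodule0 subS.
  by exists 1; rewrite scale1r.
split; rewrite TU //.
move=> _ [s [_ [Ss [r ->] ->]]] Nsr; apply: contrapT => /eqP n0.
by apply: none; exists r, s.
Qed.

(** The elementwise form of essentiality, in which only multiples of single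
    elements have to be examined. *)
Definition ess V (S : set V) : Prop :=
  submodule S /\ forall x, x != 0 -> exists2 r, S (r *: x) & r *: x != 0.

Lemma essentialP V (S : {pred V}) : essential S <-> ess (fun x => x \in S).
Proof.
split=> -[subS essS]; split=> //.
  move=> x x0; have subL := submodule_line x.
  have [|y [Sy /asboolP[r yE] y0]] := essS _ (submod_mem_closed subL).
    by exists x => //; apply/asboolP; exists 1; rewrite scale1r.
  by exists r; rewrite -yE.
move=> T subT [x Tx x0]; have [r Sr r0] := essS x x0.
by exists (r *: x); split=> //; apply: (submoduleZ (S := fun x => x \in T)).
Qed.

Lemma ess_setI V (S T : set V) :
  ess S -> ess T -> ess (fun x => S x /\ T x).
Proof.
move=> [subS essS] [subT essT]; split; first exact: submodule_setI.
move=> x /essS[r Srx rx0]; have [s Tsrx srx0] := essT _ rx0.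
by exists (s * r); rewrite -scalerA //; split=> //; apply: (submoduleZ subS).
Qed.

(** A maximal S disjoint from N is a complement up to an essential submodule. *)
Lemma complement_ess V (N S : set V) :
    submodule N -> submodule S -> (forall x, S x -> N x -> x = 0) ->
    (forall x, ~ S x -> exists r s, [/\ S s, N (s + r *: x) & s + r *: x != 0]) ->
  ess (fun x => exists s t, [/\ S s, N t & x = s + t]).
Proof.
move=> subN subS dis maxS; split; first exact: submodule_add.
move=> x x0; have [Sx|/maxS[r [s [Ss Nt t0]]]] := pselect (S x).
  exists 1; rewrite scale1r //; exists x, 0; rewrite addr0; split=> //.
  exact: submodule0 subN.
exists r.
  exists (- s), (s + r *: x); rewrite addrA addNr add0r; split=> //.
  exact: (submoduleN subS).
apply: contraNneq t0 => rx0; move: Nt; rewrite rx0 addr0 => Ns.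
by rewrite (dis s).
Qed.

Lemma ess_sub V (S T : set V) :
  submodule T -> (forall x, S x -> T x) -> ess S -> ess T.
Proof.
move=> subT ST [_ essS]; split=> // x /essS[r Sr r0].
by exists r => //; apply: ST.
Qed.

Lemma ess_preim V W (f : {linear V -> W}) (S : set W) :
  ess S -> ess (fun x => S (f x)).
Proof.
move=> [subS essS]; split; first exact: submodule_preim.
move=> x x0; have [fx0|/eqP/essS[r]] := pselect (f x = 0).
  by exists 1; rewrite scale1r ?fx0 //; apply: submodule0 subS.
rewrite -linearZ_LR => Srx rx0; exists r => //.
by apply: contraNneq rx0 => ->; rewrite linear0.
Qed.

Lemma linear_scale_by V (x : V) : linear (fun r : R^o => (r : R) *: x).
Proof. by move=> a b c; rewrite scalerDl scalerA. Qed.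

Definition scale_by V (x : V) : {linear R^o -> V} :=
  linear_of (linear_scale_by x).

Definition left_ideal (I : set R) : Prop := submodule (I : set R^o).
Definition ess_ideal (I : set R) : Prop := ess (I : set R^o).

Lemma ess_colon V (S : set V) x : ess S -> ess_ideal (fun r => S (r *: x)).
Proof. exact: (ess_preim (scale_by x)). Qed.

Definition singular V (x : V) : Prop := ess_ideal (fun r => r *: x = 0).

Lemma singularP V (x : V) : singular_element x <-> singular x.
Proof.
rewrite /singular_element essentialP /singular /ess_ideal.
suff -> : (fun r : R^o => is_true (r \in [pred r : R^o | (r : R) *: x == 0])) =
          (fun r : R => r *: x = 0) by [].
by apply/funext => r; apply/propext; rewrite inE; split=> /eqP.
Qed.

Lemma singular_submodule V : submodule (@singular V).
Proof.
split.
  split; last by move=> r r0; exists 1; rewrite scale1r // scaler0.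
  by split=> [|r u v _ _]; rewrite scaler0.
move=> r u v su sv; apply: ess_sub (ess_setI (ess_colon (r : R^o) su) sv).
  exact: (submodule_ker (scale_by (r *: u + v))).
by move=> s [su0 sv0]; rewrite scalerDr sv0 addr0 scalerA.
Qed.

Lemma singular_im V W (f : {linear V -> W}) x : singular x -> singular (f x).
Proof.
apply: ess_sub; first exact: (submodule_ker (scale_by (f x))).
by move=> r rx0; rewrite -linearZ_LR rx0 linear0.
Qed.

Lemma singular_inj V W (f : {linear V -> W}) x :
  injective f -> singular (f x) -> singular x.
Proof.
move=> fi; apply: ess_sub; first exact: (submodule_ker (scale_by x)).
by move=> r; rewrite -linearZ_LR -(linear0 f) => /fi.
Qed.

Lemma semilinear0 M (I : set R) (h : R -> M) :
    left_ideal I ->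
    (forall r a b, I a -> I b -> h (r * a + b) = r *: h a + h b) ->
  h 0 = 0.
Proof.
move=> subI hP; have I0 := submodule0 subI; have := hP 1 0 0 I0 I0.
by rewrite scale1r mul1r addr0 => /esym/(canRL (addrK _)); rewrite subrr.
Qed.

(** It is enough to extend maps from essential left ideals: a maximal partial
    extension is defined on an essential submodule, as it could be extended by 0
    to any x with no nonzero multiple in its domain. *)
Lemma baer M :
  (forall (I : set R) (h : R -> M), ess_ideal I ->
     (forall r a b, I a -> I b -> h (r * a + b) = r *: h a + h b) ->
     exists m, forall a, I a -> h a = a *: m) ->
  injective_module M.
Proof.
move=> ext A B i f ii.
pose N (z : B * M) := z.1 = 0.
have subN : submodule N by apply: submodule_ker.
have graphL : linear (fun a => (i a, f a)) by move=> r a b; rewrite !linearP.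
have [|G [subG G0G disG maxG]] :=
    maximal_disjoint subN (submodule_range (linear_of graphL)).
  move=> _ [a <-]; rewrite /N /= -(linear0 i) => /ii->.
  by rewrite (linear0 i) (linear0 f).
have funG b m m' : G (b, m) -> G (b, m') -> m = m'.
  move=> Gm Gm'; have := submoduleB subG Gm Gm'.
  move=> /disG; rewrite /N /= subrr => /(_ erefl) /(congr1 snd) /= /eqP.
  by rewrite subr_eq0 => /eqP.
have totG b : exists m, G (b, m).
  pose I r := exists m, G (r *: b, m).
  have [h hP] : exists h : R -> M, forall r, I r -> G (r *: b, h r).
    have /choice[h hP] : forall r, exists m, I r -> G (r *: b, m).
      move=> r; have [[m Gm]|nI] := pselect (I r); first by exists m.
      by exists 0.
    by exists h.
  have comb r a c : I a -> I c -> G ((r * a + c) *: b, r *: h a + h c).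
    move=> /hP Ga /hP Gc.
    by rewrite scalerDl -scalerA; apply: (subG.2 r _ _ Ga Gc).
  have subI : left_ideal I.
    split; first by exists 0; rewrite scale0r; apply: submodule0 subG.
    by move=> r a c Ia Ic; exists (r *: h a + h c); apply: comb.
  have [||m hm] := ext I h.
  - split=> //; suff essI (r : R) : r != 0 -> exists2 s, I (s * r) & s * r != 0.
      exact: essI.
    move=> r0; have [rb0|rb0] := eqVneq (r *: b) 0.
      by exists 1; rewrite mul1r //; exists 0; rewrite rb0;
        apply: submodule0 subG.
    have [|/maxG[s [[c m] [Gg /= Ng gn0]]]] := pselect (G (r *: b, 0)).
      by exists 1; rewrite mul1r //; exists 0.
    rewrite /N /= in Ng.
    have srb : (s * r) *: b = - c.
      by rewrite -scalerA; apply/eqP; rewrite -addr_eq0 addrC; apply/eqP.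
    exists s; first by exists (- m); rewrite srb; apply: (submoduleN subG Gg).
    apply: contraNneq gn0 => sr0.
    have c0 : c = 0 by apply: oppr_inj; rewrite -srb sr0 scale0r oppr0.
    apply/eqP; have := disG _ Gg; rewrite /N /= c0 => /(_ erefl)[->].
    by congr pair; rewrite /= ?add0r ?scaler0 // scalerA sr0 scale0r.
  - move=> r a c Ia Ic; apply: funG (hP _ _) (comb _ _ _ Ia Ic).
    by exists (r *: h a + h c); apply: comb.
  apply: contrapT => nGb.
  have [|s [[c n] [Gg /= Ng gn0]]] := maxG (b, m).
    by move=> Gb; apply: nGb; exists m.
  have sb : s *: b = - c by apply/eqP; rewrite -addr_eq0 addrC; apply/eqP.
  have Is : I s by exists (- n); rewrite sb; apply: (submoduleN subG Gg).
  have nh : h s = - n.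
    by apply: funG (hP _ Is) _; rewrite sb; apply: (submoduleN subG Gg).
  move: gn0; rewrite -[s *: (b, m)]/(s *: b, s *: m) -hm // nh sb.
  by rewrite -[_ + _]/(c - c, n - n) !subrr eqxx.
have [h hG] := @linear_of_rel _ B M (fun b m => G (b, m)) totG funG
  (fun r b b' m m' => @subG.2 r _ _).
exists h => a; apply: funG (hG _) _; apply: G0G; by exists a.
Qed.

End Essential.

Section Injective.
Variable R : pzRingType.
Implicit Types V W A B C M : lmodType R.

Lemma injective_extend M A B (u : {linear A -> B}) (f : {linear A -> M}) :
    injective_module M -> (forall a, u a = 0 -> f a = 0) ->
  exists g : {linear B -> M}, forall a, g (u a) = f a.
Proof.
move=> injM kf.
have [W [i [ii iP]]] := submodule_typeP (submodule_range u).
have imu a : exists w, i w = u a by apply/iP; exists a.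
have [p pP] := linear_corestrict ii imu.
have [w|a pa|h hP] := @linear_descend _ A W M p f.
- have /iP[a wE] : exists w', i w' = i w by exists w.
  by exists a; apply: ii; rewrite pP.
- by apply: kf; rewrite -pP pa linear0.
have [g gP] := injM _ _ i h ii.
by exists g => a; rewrite -pP gP hP.
Qed.
End Injective.

(** * Finitely generated submodules over a noetherian ring *)

Section Span.
Variable R : pzRingType.
Implicit Types V W : lmodType R.

Fixpoint lspan V (s : seq V) : set V :=
  if s is x :: s' then fun v => exists r, lspan s' (v - r *: x)
  else fun v => v = 0.

Lemma lspan_submodule V (s : seq V) : submodule (lspan s).
Proof.
elim: s => [|x s [s0 sP]] /=.
  by split=> // r u v -> ->; rewrite scaler0 addr0.
split; first by exists 0; rewrite scale0r subr0.
move=> r u v [a ua] [b vb]; exists (r * a + b).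
by rewrite scalerDl -scalerA opprD addrACA -scalerBr; apply: sP.
Qed.

Lemma lspan_mem V (s : seq V) x : x \in s -> lspan s x.
Proof.
elim: s => //= y s IH; rewrite inE => /predU1P[->|/IH sx].
  by exists 1; rewrite scale1r subrr; apply: submodule0 (lspan_submodule s).
by exists 0; rewrite scale0r subr0.
Qed.

Lemma lspan_min V (s : seq V) (S : set V) :
  submodule S -> (forall x, x \in s -> S x) -> forall v, lspan s v -> S v.
Proof.
move=> subS; elim: s => [|x s IH] sS v /=.
  by move->; apply: submodule0 subS.
move=> [r sv]; rewrite -[v](subrK (r *: x)); apply: (submoduleD subS).
  by apply: IH => // y ys; apply: sS; rewrite inE ys orbT.
by apply: (submoduleZ subS); apply: sS; rewrite inE eqxx.
Qed.

Lemma lspan_sub V (s t : seq V) :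
  (forall x, x \in s -> x \in t) -> forall v, lspan s v -> lspan t v.
Proof.
by move=> st; apply: lspan_min; [apply: lspan_submodule|move=> x /st/lspan_mem].
Qed.

Definition fg_sub V (S : set V) : Prop := exists s : seq V, S = lspan s.

(** Otherwise, adding elements one at a time gives a strictly increasing chain of
    spans. *)
Lemma noetherian_fg V (S : set V) :
  noetherian_module V -> submodule S -> fg_sub S.
Proof.
move=> noeth subS; apply: contrapT => nfg.
pose inS (s : seq V) := forall x, x \in s -> S x.
have grow (s : seq V) : exists x, inS s -> S x /\ ~ lspan s x.
  have [sS|] := pselect (inS s); last by move=> ns; exists 0 => /ns.
  apply: contrapT => none; apply: nfg; exists s.
  apply/seteqP; split=> [x Sx|]; last by apply: lspan_min.
  by apply: contrapT => nx; apply: none; exists x.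
have [next nextP] := choice grow.
pose u n := iter n (fun s => next s :: s) [::].
have uS n : inS (u n).
  elim: n => // n IH x; rewrite inE => /predU1P[->|/IH//].
  by have [] := nextP _ IH.
have [||n /(_ n.+1 (leqnSn n)) eqn] := noeth (fun n => submod_mem (lspan (u n))).
- by move=> n; apply/submod_mem_closed/lspan_submodule.
- move=> n x /asboolP ux; apply/asboolP; apply: lspan_sub ux => y yu.
  by rewrite inE yu orbT.
have [_ []] := nextP _ (uS n).
apply/asboolP; rewrite -[`[< _ >]]eqn; apply/asboolP/lspan_mem.
by rewrite inE eqxx.
Qed.

(** Induction on the list x :: s: the coefficients of x in the elements of S form
    a left ideal, and a finite generating set of this ideal lifts to S; what is
    left of S lies in the span of s. *)
Lemma noetherian_lspan V (s : seq V) (S : set V) :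
    left_noetherian R -> submodule S -> (forall v, S v -> lspan s v) ->
  fg_sub S.
Proof.
move=> noeth; elim: s S => [|x s IH] S subS sS.
  by exists [::]; apply/seteqP; split=> [v /sS|v ->] //; apply: submodule0 subS.
pose I (r : R^o) := exists2 v, lspan s v & S ((r : R) *: x + v).
have subI : submodule I.
  split; first by exists 0; rewrite ?scale0r ?addr0; apply: submodule0 => //;
    apply: lspan_submodule.
  move=> r a b [u su Su] [v sv Sv]; exists (r *: u + v).
    exact: (lspan_submodule s).2.
  have -> : (r *: a + b : R) *: x + (r *: u + v) =
            r *: ((a : R) *: x + u) + ((b : R) *: x + v).
    by rewrite scalerDl -scalerA addrACA scalerDr.
  exact: subS.2.
have [t It] := noetherian_fg noeth subI.
have [t' St'] : fg_sub (fun v => S v /\ lspan s v).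
  by apply: IH => [|v []//]; apply: submodule_setI => //; apply: lspan_submodule.
have /choice[w wP] : forall r : R^o,
    exists v, I r -> lspan s v /\ S ((r : R) *: x + v).
  by move=> r; have [[v]|nI] := pselect (I r); [exists v|exists 0].
exists ([seq (r : R) *: x + w r | r <- t] ++ t').
pose T := lspan ([seq (r : R) *: x + w r | r <- t] ++ t').
have subT : submodule T by apply: lspan_submodule.
have T't v : S v -> lspan s v -> T v.
  move=> Sv sv; have : lspan t' v by rewrite -St'.
  by apply: lspan_sub => y yt; rewrite mem_cat yt orbT.
apply/seteqP; split=> v; last first.
  move: v; apply: lspan_min => // y; rewrite mem_cat => /orP[/mapP[r rt ->]|yt].
    by have [|_ //] := wP r; rewrite It; apply: lspan_mem.
  by have := lspan_mem yt; rewrite -St' => -[].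
move=> Sv; have [r svr] := sS v Sv.
have : lspan t (r : R^o).
  by rewrite -It; exists (v - r *: x) => //; rewrite addrCA subrr addr0.
have key (a : R^o) : lspan t a ->
    exists2 y, lspan s y & T ((a : R) *: x + y) /\ S ((a : R) *: x + y).
  move: a.
  apply: lspan_min.
    split; first by exists 0; rewrite ?scale0r ?addr0; do ?split;
      apply: submodule0 => //; apply: lspan_submodule.
    move=> c a b [y sy [Ty Sy]] [z sz [Tz Sz]]; exists (c *: y + z).
      exact: (lspan_submodule s).2.
    have -> : (c *: a + b : R) *: x + (c *: y + z) =
            c *: ((a : R) *: x + y) + ((b : R) *: x + z).
      by rewrite scalerDl -scalerA addrACA scalerDr.
    by split; [apply: subT.2|apply: subS.2].
  move=> a at_; have [|sw Sw] := wP a; first by rewrite It; apply: lspan_mem.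
  exists (w a) => //; split=> //.
  by apply: lspan_mem; rewrite mem_cat; apply/orP; left; apply/mapP; exists a.
move=> /key[y sy [Ty Sy]].
rewrite -[v](addrNK (r *: x + y)); apply: (submoduleD subT) => //.
apply: T't; first by have := submoduleB subS Sv Sy.
by have := submoduleB (lspan_submodule s) svr sy; rewrite opprD addrA.
Qed.

Lemma lspan_row n : exists s : seq 'rV[R]_n, forall v, lspan s v.
Proof.
exists [seq delta_mx 0 i | i : 'I_n] => v; rewrite [v]row_sum_delta.
apply: (submodule_sum (lspan_submodule _)) => i.
apply: (submoduleZ (lspan_submodule _)); apply: lspan_mem.
by apply: map_f; rewrite mem_enum.
Qed.

Lemma linear_combinations n V (e : 'I_n -> V) :
  linear (fun u : 'rV[R]_n => \sum_i u 0 i *: e i).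
Proof.
move=> r u v; rewrite scaler_sumr -big_split; apply: eq_bigr => i _ /=.
by rewrite !mxE scalerDl scalerA.
Qed.

Definition combination n V (e : 'I_n -> V) : {linear 'rV[R]_n -> V} :=
  linear_of (linear_combinations e).

Lemma combination_delta n V (e : 'I_n -> V) i :
  combination e (delta_mx 0 i) = e i.
Proof.
rewrite /= (bigD1 i) //= big1 ?addr0; first by rewrite mxE !eqxx scale1r.
by move=> j ji; rewrite mxE eqxx (negbTE ji) scale0r.
Qed.

End Span.

(** * An injective cogenerator of abelian groups *)

Section Cogenerator.

(** The generator is an element of least positive absolute value, or 0. *)
Lemma int_ideal (I : set int) : left_ideal I ->
  exists2 n : int, I n & forall k, I k -> exists q, k = q * n.
Proof.
move=> subI.
have [[k [Ik k0]]|none] := pselect (exists k, I k /\ k != 0); last first.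
  exists 0; first exact: submodule0 subI.
  move=> k Ik; exists 0; rewrite mul0r; apply: contrapT => /eqP k0.
  by apply: none; exists k.
have exn : exists n : nat, (0 < n)%N && `[< I n%:Z >].
  exists `|k|%N; rewrite absz_gt0 k0; apply/asboolP.
  have [kp|/ltW kn] := lerP 0 k; first by rewrite gez0_abs.
  by rewrite lez0_abs //; apply: (submoduleN subI).
case: (ex_minnP exn) => n /andP[n0 /asboolP In] minn; exists n%:Z => // j Ij.
exists (j %/ n)%Z; rewrite {1}(divz_eq j n).
suff -> : (j %% n)%Z = 0 by rewrite addr0.
have Ir : I (j %% n)%Z.
  rewrite /modz; apply: (submoduleB subI) => //.
  exact: (submoduleZ subI (j %/ n)%Z In).
have nz : n%:Z != 0 by rewrite -lt0n in n0 *; case: n n0 {In minn Ir}.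
apply: contrapT => /eqP r0.
have rpos := modz_ge0 j nz.
have := minn `|(j %% n)%Z|%N; rewrite absz_gt0 r0 /=.
have -> : (`|(j %% n)%Z|%N : int) = (j %% n)%Z by rewrite gez0_abs.
rewrite asboolT // => /(_ isT); rewrite leqNgt => /negP; apply.
by rewrite -ltz_nat gez0_abs // ltz_mod.
Qed.

Definition int_rats (q : zmodule rat) : Prop := (q : rat) \is a Num.int.

Lemma int_rats_submodule : submodule int_rats.
Proof.
split; first exact: rpred0.
move=> r u v Iu Iv; rewrite /int_rats rpredD //.
by rewrite scalezrE rpredMz.
Qed.

(** Abelian groups are handled as integer modules, so that Baer's criterion and
    the quotient construction apply to them. *)
Definition cogenerator (D : lmodType int) : Prop :=
  injective_module D /\
  forall (G : lmodType int) (x : G), x != 0 ->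
    exists phi : {linear G -> D}, phi x != 0.

(** D = Q / Z, which is divisible and has elements of every finite order. *)
Lemma exists_cogenerator : exists D : lmodType int, cogenerator D.
Proof.
have [D [p [sp kp]]] := quotient_moduleP int_rats_submodule.
have divD (n : int) (d : D) : n != 0 -> exists m, d = n *: m.
  move=> n0; have [q <-] := sp d; exists (p ((q : rat) / n%:~R)).
  rewrite -linearZ; congr (p _); rewrite scalezrE -mulrzl mulrC divfK //.
  by rewrite intr_eq0.
have injD : injective_module D.
  apply: baer => I h [subI _] hP.
  have h0 := semilinear0 subI hP.
  have [n In nP] := int_ideal subI.
  have [n0|n0] := eqVneq n 0.
    by exists 0 => k /nP[q ->]; rewrite n0 mulr0 h0 scaler0.
  have [m mP] := divD n (h n) n0; exists m => k /nP[q ->].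
  by have := hP q n 0 In (submodule0 subI); rewrite !addr0 h0 addr0 => ->;
    rewrite mP scalerA.
exists D; split=> // G x x0.
have invint (n : int) : int_rats (n%:~R^-1 : rat) -> n != 0 -> exists m,
  m * n = 1.
  move=> /intrP[m mE] n0; exists m.
  by apply: (@intr_inj rat); rewrite intrM -mE mulVf // intr_eq0.
have [n nx nP] := int_ideal (submodule_ker (scale_by x)).
(* If x has infinite order, n = 0 and any nonzero c maps x to c; otherwise c is
   the class of 1 / n. *)
have [c c0 nc] : exists2 c : D, c != 0 & n *: c = 0.
  have [n0|n0] := eqVneq n 0.
    exists (p (2%:~R^-1 : rat)); last by rewrite n0 scale0r.
    by apply/eqP => /kp/invint[] // m /(congr1 (fun k => k %% 2)%Z);
      rewrite modzMl.
  exists (p (n%:~R^-1 : rat)); last first.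
    rewrite -linearZ; apply/kp; rewrite scalezrE -mulrzl mulfV ?intr_eq0 //.
  apply/eqP => /kp/invint[] // m mn1.
  by move: x0; rewrite -[x]scale1r -mn1 -scalerA (nx : n *: x = 0) scaler0 eqxx.
have [A [i [ii iP]]] := submodule_typeP (submodule_line x).
have [|a d d' [k ik ->] [k' ik' ->]|r a a' d d' [k ik ->] [k' ik' ->]|f fP] :=
    @linear_of_rel _ A D (fun a d => exists2 k : int, i a = k *: x & d = k *: c).
- move=> a; have /iP[k ka] : exists b, i b = i a by exists a.
  by exists (k *: c), k.
- apply/eqP; rewrite -subr_eq0 -scalerBl.
  have [|q ->] := nP (k - k').
    by rewrite /= scalerBl -ik -ik' subrr.
  by rewrite -scalerA nc scaler0.
- exists (r * k + k'); first by rewrite linearP ik ik' scalerDl scalerA.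
  by rewrite scalerDl scalerA.
have [g gP] := injD _ _ i f ii.
have /iP[a ia] : exists r, x = r *: x by exists 1; rewrite scale1r.
exists g; rewrite -ia gP; have [k] := fP a; rewrite ia => kx ->.
have [|q qE] := nP (1 - k); first by rewrite /= scalerBl scale1r -kx subrr.
have -> : k = 1 - q * n by rewrite -qE opprB addrCA subrr addr0.
by rewrite scalerBl scale1r -scalerA nc scaler0 subr0.
Qed.
End Cogenerator.

Section Characters.

Lemma int_linear (A B : lmodType int) (f : {additive A -> B}) : linear f.
Proof.
by move=> k u v; rewrite raddfD -[k in LHS]intz -[k in RHS]intz !scaler_int
  raddfMz.
Qed.

Variables (D : lmodType int) (cogD : cogenerator D).

Definition zlinear_of (A B : zmodType) (f : {additive A -> B}) :
  {linear zmodule A -> zmodule B} :=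
    linear_of (@int_linear (zmodule A) (zmodule B) f).

Lemma character_extend (A B : zmodType)
    (u : {additive A -> B}) (f : {additive A -> D}) :
    (forall a, u a = 0 -> f a = 0) ->
  exists g : {additive B -> D}, forall a, g (u a) = f a.
Proof.
move=> kf.
have [|g gP] := @injective_extend _ D _ _ (zlinear_of u)
    (linear_of (@int_linear (zmodule A) D f)) cogD.1.
  exact: kf.
have gD : zmod_morphism (g : B -> D) by exact: (raddfB g).
by exists (additive_of gD) => a; exact: (gP a).
Qed.

Lemma additive_coordinates m (N T : zmodType)
    (G : {additive {ffun 'I_m -> N} -> T}) :
  exists c : 'I_m -> {additive N -> T},
    (forall w, G w = \sum_i c i (w i)) /\
    forall i x, c i x = G [ffun k => if k == i then x else 0].
Proof.
pose inj i (x : N) : {ffun 'I_m -> N} := [ffun k => if k == i then x else 0].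
have injB i : zmod_morphism (fun x => G (inj i x)).
  move=> x y; rewrite -raddfB; congr (G _); apply/ffunP => k; rewrite !ffunE.
  by case: eqP => // _; rewrite subr0.
exists (fun i => additive_of (injB i)); split=> // w.
rewrite -raddf_sum; congr (G _); apply/ffunP => k; rewrite sum_ffunE.
rewrite (bigD1 k) //= ffunE eqxx big1 ?addr0 // => i ik.
by rewrite ffunE eq_sym (negbTE ik).
Qed.

Lemma character_separate (A B : zmodType) (u : {additive A -> B}) (b : B) :
    (forall a, u a <> b) ->
  exists phi : {additive B -> D}, (forall a, phi (u a) = 0) /\ phi b != 0.
Proof.
move=> nb.
have [W [p [sp pP]]] := cokernelP (zlinear_of u).
have pb : p b != 0 by apply/eqP => /pP[a bE]; apply: (nb a).
have [psi psib] := cogD.2 _ _ pb.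
have psipD : zmod_morphism (fun x : B => psi (p x)).
  by move=> x y; rewrite (raddfB p) raddfB.
exists (additive_of psipD); split=> //= a.
suff -> : p (u a) = 0 by rewrite linear0.
by apply/pP; exists a.
Qed.

End Characters.

Lemma freeg_int_ind (K : choiceType) (P : {freeg K / int} -> Prop) :
    P 0 -> (forall s t, P s -> P t -> P (s - t)) -> (forall x, P << x >>) ->
  forall t, P t.
Proof.
move=> P0 PB Px t.
have PN s : P s -> P (- s) by move=> Ps; rewrite -sub0r; apply: PB.
have PD s u : P s -> P u -> P (s + u).
  by move=> Ps /PN Pu; rewrite -[u]opprK; apply: PB.
rewrite -[t]freeg_sumE; elim/big_rec: _ => // x s _ Ps; apply: (PD) => //.
rewrite -[coeff _ _]intz -freegU_mulz.
have PMn n : P (<< x >> *+ n).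
  by elim: n => [|n IH]; rewrite ?mulr0n // mulrS; apply: PD.
by case: (coeff _ _) => n; [exact: PMn | apply: PN; exact: PMn].
Qed.

(** * Tensor products and character modules *)

Section TensorLift.
Variables (R : pzRingType) (X : lmodType R^c) (A : lmodType R).

Definition balanced (T : zmodType) (b : X -> A -> T) : Prop :=
  [/\ forall x x' a, b (x + x') a = b x a + b x' a,
      forall x a a', b x (a + a') = b x a + b x a' &
      forall x (r : R) a, b ((r : R^c) *: x) a = b x (r *: a)].

(** The universal property, for additive maps.  On the free abelian group the map
    is given by its values on generators; it vanishes on [tensor_null], the least
    subgroup containing the relators. *)
Lemma tensor_lift (T : zmodType) (b : X -> A -> T) : balanced b ->
  exists phi : {additive tensor X A -> T}, forall x a, phi (tens x a) = b x a.
Proof.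
move=> [bDl bDr bZ].
pose l : {freeg (X * A) / int} -> zmodule T :=
  fglift (fun p => b p.1 p.2 : zmodule T).
have lB u v : l (u - v) = l u - l v by exact: lift_is_additive.
have lU x a : l << (x, a) >> = b x a by rewrite /l liftU scale1r.
have l0 : l 0 = 0 by rewrite -(subrr 0) lB subrr.
have lnull t : t \in @tensor_null R X A -> l t = 0.
  move=> /asboolP /(_ [pred t | l t == 0]) lt; apply/eqP/lt.
    split=> [|u v]; rewrite !inE ?l0 // lB => /eqP-> /eqP->.
    by rewrite subrr.
  move=> s []; move=> *; rewrite inE !lB !lU ?bDl ?bDr ?bZ ?subrr //.
    by rewrite -addrA -opprD subrr.
  by rewrite -addrA -opprD subrr.
pose phi (t : tensor X A) : T := l (repr t).
have phiE t : phi (\pi_(tensor X A) t) = l t.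
  apply/eqP; rewrite -subr_eq0 -[_ - _]lB; apply/eqP/lnull.
  by apply/tensor_piP; rewrite reprK.
have phiB : zmod_morphism phi.
  by move=> s t; rewrite -[s]reprK -[t]reprK -tens_pi_is_zmod_morphism !phiE lB.
by exists (additive_of phiB) => x a; rewrite /= phiE lU.
Qed.

Lemma tensor_ind (P : tensor X A -> Prop) :
  P 0 -> (forall s t, P s -> P t -> P (s - t)) -> (forall x a, P (tens x a)) ->
  forall t, P t.
Proof.
move=> P0 PB Pt t; rewrite -[t]reprK; elim/freeg_int_ind: (repr t) => //.
- by rewrite -(subrr 0) tens_pi_is_zmod_morphism subrr.
- by move=> u v Pu Pv; rewrite tens_pi_is_zmod_morphism; apply: PB.
- by move=> [x a]; apply: Pt.
Qed.

Lemma tensor_add_ext (T : zmodType) (f g : {additive tensor X A -> T}) :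
  (forall x a, f (tens x a) = g (tens x a)) -> forall t, f t = g t.
Proof.
move=> fg; apply: tensor_ind => // [|s t fs ft]; first by rewrite !raddf0.
by rewrite !raddfB fs ft.
Qed.

End TensorLift.

Section CharacterModule.
Variables (R : pzRingType) (X : lmodType R^c) (D : lmodType int).

Definition char_mem : {pred X -> D} := fun f => `[< zmod_morphism f >].

Lemma char_mem_closed : zmod_closed char_mem.
Proof.
split=> [|f g /asboolP fB /asboolP gB]; apply/asboolP => x y.
  by rewrite -[RHS]/(0 - 0) subr0.
rewrite -[LHS]/(f (x - y) - g (x - y)) -[RHS]/((f x - g x) - (f y - g y)).
by rewrite fB gB !opprD !opprK addrACA.
Qed.

HB.instance Definition _ :=
  GRing.isZmodClosed.Build (X -> D) char_mem char_mem_closed.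

(** X^+: [(r *: c) x = c (x r)], the product x r being written [(r : R^c) *: x]
    in the right module X. *)
Definition char : Type := {f : X -> D | f \in char_mem}.
HB.instance Definition _ := SubChoice.on char.
HB.instance Definition _ := [SubChoice_isSubZmodule of char by <:].

Definition ev (c : char) : X -> D := val c.
Lemma ev_zmod_morphism c : zmod_morphism (ev c).
Proof. exact/asboolP/(valP c). Qed.
HB.instance Definition _ c :=
  GRing.isZmodMorphism.Build X D (ev c) (ev_zmod_morphism c).

Definition Char (f : {additive X -> D}) : char :=
  exist _ (f : X -> D) (asboolT (raddfB f : zmod_morphism f)).

Lemma CharE f x : ev (Char f) x = f x. Proof. by []. Qed.

Lemma char_ext (c d : char) : (forall x, ev c x = ev d x) -> c = d.
Proof. by move=> cd; apply/val_inj/funext. Qed.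

Lemma ev0 x : ev 0 x = 0. Proof. by []. Qed.
Lemma evD c d x : ev (c + d) x = ev c x + ev d x. Proof. by []. Qed.

Fact char_scale_subproof (r : R) (c : char) :
  zmod_morphism (fun x => ev c ((r : R^c) *: x)).
Proof. by move=> x y; rewrite scalerBr raddfB. Qed.

Definition char_scale r c : char := Char (additive_of (char_scale_subproof r c)).

Fact char_scalerA r s c : char_scale r (char_scale s c) = char_scale (r * s) c.
Proof.
apply: char_ext => x.
rewrite -[LHS]/(ev c ((s : R^c) *: ((r : R^c) *: x))) scalerA.
by [].
Qed.
Fact char_scale1r : left_id 1 char_scale.
Proof. by move=> c; apply: char_ext => x; exact: (congr1 (ev c) (scale1r x)). Qed.
Fact char_scalerDr : right_distributive char_scale +%R.
Proof. by move=> r c d; apply: char_ext => x; rewrite CharE evD /= evD. Qed.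
Fact char_scalerDl c : {morph char_scale^~ c : r s / r + s}.
Proof.
move=> r s; apply: char_ext => x; rewrite evD.
rewrite -[RHS]/(ev c ((r : R^c) *: x) + ev c ((s : R^c) *: x)) -raddfD -scalerDl.
by [].
Qed.

HB.instance Definition _ := GRing.Zmodule_isLmodule.Build R char
  char_scalerA char_scale1r char_scalerDr char_scalerDl.

Lemma evZ r c x : ev (r *: c) x = ev c ((r : R^c) *: x). Proof. by []. Qed.

Lemma ev_sum (I : Type) (s : seq I) (c : I -> char) x :
  ev (\sum_(i <- s) c i) x = \sum_(i <- s) ev (c i) x.
Proof. by elim/big_rec2: _ => // i y z _ <-; rewrite evD. Qed.

(** A linear map A -> X^+ is an additive map on X (x) A, and purity embeds
    X (x) A into X (x) B, along which D is injective. *)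
Lemma char_pure_injective : cogenerator D -> pure_injective (char : lmodType R).
Proof.
move=> cogD A B C i p f [_ /(_ X)[injti _ _]].
have [|phi phiE] := @tensor_lift R X A D (fun x a => ev (f a) x).
  split=> [x x' a|x a a'|x r a]; first by rewrite raddfD.
    by rewrite linearD evD.
  by rewrite linearZ evZ.
have tiB : zmod_morphism (tensor_map (@idfun X) i).
  exact: (tensor_map_is_zmod_morphism (idfun : {linear X -> X}) i).
have [t|psi psiE] := character_extend cogD (u := additive_of tiB) (f := phi).
  rewrite -(raddf0 (additive_of tiB)) => /injti->.
  by rewrite raddf0.
have hB b : zmod_morphism (fun x : X => psi (tens x b)).
  move=> x y; rewrite -raddfB; congr (psi _).
  by apply: (addIr (tens y b)); rewrite -tensDl !subrK.
have hL : linear (fun b => Char (additive_of (hB b))).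
  move=> r b b'; apply: char_ext => x.
  by rewrite evD evZ !CharE /= tensDr raddfD tens_bal.
exists (linear_of hL) => a; apply: char_ext => x.
rewrite /= CharE /= -phiE -psiE /=; congr (psi _).
by rewrite (tensor_mapE (idfun : {linear X -> X}) i).
Qed.
End CharacterModule.

Section OppositeModule.
Variables (R : pzRingType) (N : lmodType R).
(** [N] seen as a right module over the opposite ring, so that [char] makes N^+ a
    right R-module.  The rings R and (R^c)^c have the same operations but are
    different structures. *)
Definition op_module : Type := N.
HB.instance Definition _ := GRing.Zmodule.on op_module.
Definition op_scale (r : R^c^c) (x : op_module) : op_module := (r : R) *: (x : N).
Fact op_scalerA r s x : op_scale r (op_scale s x) = op_scale (r * s) x.
Proof. exact: scalerA. Qed.
Fact op_scale1r : left_id 1 op_scale. Proof. exact: scale1r. Qed.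
Fact op_scalerDr : right_distributive op_scale +%R.
Proof. by move=> r x y; exact: (scalerDr (r : R) (x : N) (y : N)). Qed.
Fact op_scalerDl x : {morph op_scale^~ x : r s / r + s}.
Proof. by move=> r s; exact: (scalerDl (x : N) (r : R) (s : R)). Qed.
HB.instance Definition _ := GRing.Zmodule_isLmodule.Build R^c^c op_module
  op_scalerA op_scale1r op_scalerDr op_scalerDl.
End OppositeModule.

(** * Systems of equations, purity and absolute purity *)

Section Systems.
Variables (R : pzRingType) (D : lmodType int) (cogD : cogenerator D).
Implicit Types N K M : lmodType R.

(** If y is outside the subgroup A N^n of N^m, a character of N^m separates them;
    it is described by its m coordinates. *)
Lemma unsolvable_character m n (A : 'I_m -> 'I_n -> R) N (y : 'I_m -> N) :
    (forall z : 'I_n -> N, ~ forall i, y i = \sum_j A i j *: z j) ->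
  exists phi : 'I_m -> {additive N -> D},
    (forall z : 'I_n -> N, \sum_i phi i (\sum_j A i j *: z j) = 0) /\
    \sum_i phi i (y i) != 0.
Proof.
move=> noz.
pose u (z : {ffun 'I_n -> N}) : {ffun 'I_m -> N} :=
  [ffun i => \sum_j A i j *: z j].
have uB : zmod_morphism u.
  move=> z z'; apply/ffunP => i; rewrite !ffunE -sumrB; apply: eq_bigr => j _.
  by rewrite !ffunE scalerBr.
have [|phi [phiu phiy]] :=
    character_separate cogD (u := additive_of uB) (b := finfun y).
  by move=> z /ffunP uz; apply: (noz z) => i; have := uz i; rewrite !ffunE.
have [c [phiE _]] := additive_coordinates phi.
exists c; split=> [z|].
  rewrite -[RHS](phiu (finfun z)) phiE; apply: eq_bigr => i _.
  by rewrite ffunE; congr (c i _); apply: eq_bigr => j _; rewrite ffunE.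
apply: contraNneq phiy => <-; rewrite phiE.
by apply/eqP/eq_bigr => i _; rewrite ffunE.
Qed.

Lemma unsolvable_character1 k (a : 'I_k -> R) N (y : 'I_k -> N) :
    (forall z : N, ~ forall i, y i = a i *: z) ->
  exists phi : 'I_k -> {additive N -> D},
    (forall z, \sum_i phi i (a i *: z) = 0) /\ \sum_i phi i (y i) != 0.
Proof.
move=> noz; have [z yz|phi [phi0 phiy]] :=
    @unsolvable_character k 1 (fun i _ => a i) N y.
  by apply: (noz (z ord0)) => i; rewrite yz big_ord1.
exists phi; split=> // z; rewrite -[RHS](phi0 (fun _ => z)).
by apply: eq_bigr => i _; rewrite big_ord1.
Qed.

(** Otherwise some phi in (N^+)^k satisfies phi a = 0 but phi y <> 0.  In
    N^+ (x) K the element sum_j phi_j (x) i y_j equals (sum_j phi_j a_j) (x) e,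
    which is 0; by purity sum_j phi_j (x) y_j is 0 already in N^+ (x) N, and
    evaluation gives the contradiction phi y = 0. *)
Lemma pure_system N K (i : {linear N -> K})
    k (a : 'I_k -> R) (y : 'I_k -> N) (e : K) :
    (forall X : lmodType R^c, injective (tensor_map (@idfun X) i)) ->
    (forall j, i (y j) = a j *: e) ->
  exists z, forall j, y j = a j *: z.
Proof.
move=> pure_i iy; apply: contrapT => none.
have [z yz|phi [phi0 /eqP phiy]] := @unsolvable_character1 k a N y.
  by apply: none; exists z.
pose X : lmodType R^c := char (op_module N) D.
pose c j : X := Char (phi j : {additive op_module N -> D}).
have c0 : \sum_j (a j : R^c) *: c j = 0.
  by apply: char_ext => n; rewrite ev_sum ev0 -[RHS](phi0 n).
have [|eval evalE] := @tensor_lift R X N D (fun x n => ev x n).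
  split=> [x x' n|x n n'|x r n]; rewrite ?evD //.
  by rewrite (raddfD (ev x)).
pose t := additive_of (tensor_map_is_zmod_morphism (idfun : {linear X -> X}) i).
have t0 : \sum_j tens (c j) (y j) = 0 :> tensor X N.
  apply: (pure_i X); rewrite -[LHS]/(t _) -[RHS]/(t _) raddf_sum raddf0 /=.
  have lB : zmod_morphism (fun x : X => tens x e).
    by move=> x x'; apply: (addIr (tens x' e)); rewrite -tensDl !subrK.
  rewrite -[RHS](raddf0 (additive_of lB)) -c0 raddf_sum; apply: eq_bigr => j _ /=.
  by rewrite (tensor_mapE (idfun : {linear X -> X}) i) iy /= tens_bal.
apply: phiy; rewrite -[RHS](raddf0 eval) -t0 raddf_sum.
by apply: eq_bigr => j _; rewrite evalE.
Qed.

(** Given h : I -> N, the pushout K of I -> R along h contains an element e with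
    a e = h a for all a in I.  For generators a of I this is a finite system,
    which purity of N in K solves in N. *)
Lemma absolutely_pure_injective N :
  left_noetherian R -> absolutely_pure N -> injective_module N.
Proof.
move=> noeth apN; apply: baer => I h [subI _] hP.
have [s Is] := noetherian_fg noeth subI.
have h0 := semilinear0 subI hP.
pose S (x : N * R^o) := I x.2 /\ x.1 = - h x.2.
have subS : submodule S.
  split; first by split; [exact: submodule0 subI|rewrite /= h0 oppr0].
  move=> r [n a] [n' a'] [/= Ia ->] [/= Ia' ->]; split; first exact: subI.2.
  by rewrite /= hP // opprD scalerN.
have [K [p [sp pP]]] := quotient_moduleP subS.
have iL : linear (fun n : N => p (n, 0)).
  move=> r n n'; rewrite -linearP; congr (p (_, _)).
  by rewrite /= scaler0 addr0.
have ii : injective (linear_of iL).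
  move=> n n' /= /eqP; rewrite -subr_eq0 -linearB => /eqP/pP[_ /=].
  by rewrite subrr h0 oppr0 => /eqP; rewrite subr_eq0 => /eqP.
have [C [q [sq qP]]] := cokernelP (linear_of iL).
have [|_ pure_i] := apN K C (linear_of iL) q; first by split.
have memI j : I (tnth (in_tuple s) j) by rewrite Is; apply/lspan_mem/mem_tnth.
have [|j|m mP] := @pure_system N K (linear_of iL) (size s)
    (fun j => tnth (in_tuple s) j) (fun j => h (tnth (in_tuple s) j)) (p (0, 1)).
- by move=> X; have [] := pure_i X.
- have Ij := memI j; set a := tnth _ _ in Ij *.
  have a1 : a *: (1 : R^o) = a := mulr1 a.
  apply/eqP; rewrite -subr_eq0 /= -linearZ -linearB; apply/eqP/pP.
  split; rewrite /= sub0r; last first.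
    have := hP (-1) a 0 Ij (submodule0 subI); rewrite h0 !addr0 mulN1r scaleN1r.
    by rewrite scaler0 subr0 a1 => ->; rewrite opprK.
  by apply: (submoduleN subI); rewrite a1.
exists m => a Ia.
suff [] : (fun a => I a /\ h a = a *: m) a by [].
have : lspan s (a : R^o) by rewrite -Is.
move: {Ia} a; apply: (lspan_min (V := R^o)).
  split; first by split; [exact: submodule0 subI|rewrite h0 scale0r].
  move=> r a b [Ia ha] [Ib hb]; split; first exact: subI.2.
  by rewrite hP // ha hb scalerDl scalerA.
by move=> x /(tnthP (in_tuple s))[j ->].
Qed.
End Systems.

(** * The double character module of the ring *)

Section DoubleCharacter.
Variables (R : pzRingType) (D : lmodType int) (cogD : cogenerator D).

Definition regular_char : lmodType R^c := char (op_module R^o) D.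
Definition bidual : lmodType R := char regular_char D.

Hypotheses (noeth : left_noetherian R) (nonsing : left_nonsingular R).

(** Let a_1, ..., a_k generate the essential annihilator of f.  By
    nonsingularity x |-> (a_j x)_j is injective, so every character g of R has
    the form sum_j g_j a_j, and f g = sum_j (a_j f) g_j = 0. *)
Lemma bidual_nonsingular (f : bidual) : singular f -> f = 0.
Proof.
move=> [subI essI]; have [s Is] := noetherian_fg noeth subI.
pose a j : R := tnth (in_tuple s) j.
have memI j : a j *: f = 0.
  have : lspan s (a j : R^o) by apply/lspan_mem/mem_tnth.
  by rewrite -Is.
pose u (x : R) : {ffun 'I_(size s) -> R} := [ffun j => a j * x].
have uB : zmod_morphism u by move=> x y; apply/ffunP => j; rewrite !ffunE mulrBr.
have u_inj x : u x = 0 -> x = 0.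
  move=> ux; apply: nonsing; apply/singularP.
  have : ess_ideal (fun r => r *: f = 0) by split.
  apply: ess_sub; first exact: (submodule_ker (scale_by (x : R^o))).
  move=> r rf; have : lspan s r by rewrite -Is.
  move: {rf} r; apply: lspan_min.
    exact: (submodule_ker (scale_by (x : R^o))).
  move=> _ /(tnthP (in_tuple s))[j ->].
  by have /ffunP/(_ j) := ux; rewrite !ffunE.
apply: char_ext => g; rewrite ev0.
have gB : zmod_morphism (fun x : R => ev g x) by exact: (raddfB (ev g)).
have [x /u_inj-> | G GP] :=
    character_extend cogD (u := additive_of uB) (f := additive_of gB).
  by rewrite raddf0.
have [c [GE _]] := additive_coordinates G.
pose chi j : regular_char := Char (c j : {additive op_module R^o -> D}).
have -> : g = \sum_j (a j : R^c) *: chi j.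
  apply: char_ext => x; rewrite ev_sum -[LHS](GP x) GE.
  by apply: eq_bigr => j _; rewrite ffunE.
rewrite raddf_sum big1 // => j _.
by rewrite -[LHS]/(ev (a j *: f) (chi j)) memI ev0.
Qed.

(** Let C be a complement of the left annihilator I of a.  Then c a |-> c is well
    defined on C a, and injectivity of R^++ extends it to R with values in R^++;
    separating by characters, it is right multiplication by an x in R.  So
    c a x = c on C, whence a x a - a is killed by the essential ideal C + I. *)
Lemma bidual_not_injective : ~ von_neumann_regular R -> ~ injective_module bidual.
Proof.
move=> nvn inj; apply: nvn => a.
have [r_a raE] : exists r_a : {linear R^o -> R^o}, forall x, r_a x = x * a.
  by exists (scale_by (a : R^o)).
have subI := submodule_ker r_a.
have sub0 := submodule_ker (idfun : {linear R^o -> R^o}).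
have [|C [subC _ disC maxC]] := maximal_disjoint subI sub0 => //.
have [W [i [ii iP]]] := submodule_typeP subC.
have [s sE] := noetherian_fg noeth (submodule_im r_a subC).
pose t j : R := tnth (in_tuple s) j.
have /choice[c cP] : forall j, exists c : R^o, C c /\ t j = c * a.
  move=> j; have : lspan s (t j : R^o) by apply/lspan_mem/mem_tnth.
  by rewrite -sE => -[c Cc cE]; exists c; rewrite -raE.
have evB (x : R) : zmod_morphism (fun g : regular_char => ev g x) by [].
have iotaL : linear (fun x : R^o => Char (additive_of (evB x)) : bidual).
  by move=> r x y; apply: char_ext => g; rewrite evD evZ !CharE /= raddfD.
have ji : injective (r_a \o i).
  move=> w w' /eqP; rewrite -subr_eq0 -linearB => /eqP wa; apply: ii.
  apply/eqP; rewrite -subr_eq0 -linearB; apply/eqP/disC => //.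
  by apply/iP; exists (w - w').
have [h hP] := inj _ _ (r_a \o i : {linear W -> R^o})
  (linear_of iotaL \o i : {linear W -> bidual}) ji.
have [x xP] : exists x : R, forall j, c j = t j * x.
  apply: contrapT => none.
  have [z zP|phi [phi0 /eqP phic]] := @unsolvable_character1 R D cogD _ t R^o c.
    by apply: none; exists z.
  pose Phi j : regular_char := Char (phi j : {additive op_module R^o -> D}).
  apply: phic.
  have Phi0 : \sum_j (t j : R^c) *: Phi j = 0.
    by apply: char_ext => n; rewrite ev_sum ev0 -[RHS](phi0 n).
  rewrite -[RHS](raddf0 (ev (h 1))) -Phi0 raddf_sum; apply: eq_bigr => j _.
  rewrite -[RHS]/(ev (t j *: h 1) (Phi j)) -linearZ.
  have [/iP[w wc] tc] := cP j.
  have -> : t j *: (1 : R^o) = r_a (i w) by rewrite raE wc -tc; exact: mulr1.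
  by rewrite -[h _]/(h ((r_a \o i) w)) hP /= wc.
exists x.
have Cx y : C y -> y * a * x = y.
  move=> Cy.
  pose S (b : R^o) := exists z, [/\ C z, b = z * a & z = b * x].
  have [z [Cz yz zE]] : S (y * a).
    have : lspan s (y * a : R^o) by rewrite -sE; exists y; rewrite ?raE.
    move: (y * a); apply: (lspan_min (S := S)).
      split; first by exists 0; rewrite !mul0r; split=> //;
        apply: submodule0 subC.
      move=> r u v [z [Cz uz zu]] [z' [Cz' vz zv]]; exists (r *: z + z').
      split; first exact: subC.2.
        by rewrite uz vz /= -![_ *: _]/(_ * _) mulrDl mulrA.
      by rewrite [in LHS]zu [in LHS]zv -![_ *: _]/(_ * _) mulrDl mulrA.
    move=> b /(tnthP (in_tuple s))[j ->]; exists (c j).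
    by have [Cc tc] := cP j; split=> //; apply: xP.
  rewrite -zE; apply/esym/eqP; rewrite -subr_eq0; apply/eqP/disC.
    exact: (submoduleB subC).
  by rewrite raE mulrBl yz subrr.
apply/eqP; rewrite -subr_eq0; apply/eqP/(nonsing (x := a * x * a - a))/singularP.
apply: ess_sub (complement_ess subI subC disC maxC).
  exact: (submodule_ker (scale_by (a * x * a - a : R^o))).
move=> _ [y [z [Cy Iz ->]]];
  rewrite -[_ *: _]/((y + z) * _) mulrBr !mulrA !mulrDl.
have za : z * a = 0 by rewrite -raE.
by rewrite Cx // za !mul0r !addr0 subrr.
Qed.
End DoubleCharacter.

(** * Finitely generated modules *)

Section Extensions.
Variable R : pzRingType.
Implicit Types M N E K Q : lmodType R.

(** The pullback of the extension along u splits. *)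
Lemma Ext1_lift M N E Q
    (f : {linear N -> E}) (g : {linear E -> Q}) (u : {linear M -> Q}) :
    Ext1_eq0 M N -> short_exact f g ->
  exists v : {linear M -> E}, forall m, g (v m) = u m.
Proof.
move=> ext [fi kg sg].
pose S (x : E * M) := g x.1 = u x.2.
have subS : submodule S.
  split; first by rewrite /S /= !linear0.
  by move=> r [e m] [e' m']; rewrite /S /= !linearP => -> ->.
have [P [i [ii iP]]] := submodule_typeP subS.
have f0L : linear (fun n : N => (f n, 0 : M)).
  by move=> r n n'; rewrite linearP; congr pair; rewrite /= scaler0 addr0.
have [|f' f'P] := linear_corestrict ii (f := linear_of f0L).
  by move=> n; apply/iP; rewrite /S /= linear0; apply/kg; exists n.
have iS w : S (i w) by apply/iP; exists w.
pose g' : {linear P -> M} := (snd : {linear (E * M)%type -> M}) \o i.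
have [|phi [[psi phiK psiK] _ phi2]] := ext P f' g'.
  split.
  - move=> n n' nn'; apply: fi; have := f'P n; rewrite nn' f'P => -[].
    by move->.
  - move=> w; split; last by move=> [n <-]; rewrite /= f'P.
    move=> /= w0; have := iS w; rewrite /S w0 linear0 => /kg[n fn].
    by exists n; apply: ii; rewrite f'P /= fn -w0; case: (i w).
  - move=> m; have [e ge] := sg (u m).
    have /iP[w iw] : S (e, m) by [].
    by exists w; rewrite /= iw.
have psiL : linear psi by apply: can2_linear phiK psiK.
have inrL : linear (fun m : M => (0 : N, m)).
  by move=> r m m'; congr pair; rewrite /= scaler0 addr0.
exists ((fst : {linear (E * M)%type -> E}) \o
  (i \o (linear_of psiL \o linear_of inrL))) => m /=.
by have := iS (psi (0, m)); rewrite /S => ->;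
  rewrite -[(i _).2]/(g' _) -phi2 psiK.
Qed.

Lemma row_linear n M (f : {linear 'rV[R]_n -> M}) u :
  f u = \sum_j u 0 j *: f (delta_mx 0 j).
Proof.
by rewrite {1}[u]row_sum_delta linear_sum; apply: eq_bigr => j _; rewrite linearZ.
Qed.

(** The vector z defines R^n -> K and, modulo N, a map M -> K / N.  Its lift v
    satisfies v (l k) = 0, and the difference of the two maps R^n -> K takes
    values in N; z' is the vector of that difference. *)
Lemma Ext1_system n m (l : 'I_m -> 'rV[R]_n) M N K (p : {linear 'rV[R]_n -> M})
    (i : {linear N -> K}) (y : 'I_m -> N) (z : 'I_n -> K) :
    (forall w, exists u, p u = w) ->
    (forall u, p u = 0 <-> lspan (map l (enum 'I_m)) u) ->
    Ext1_eq0 M N -> injective i ->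
    (forall k, i (y k) = \sum_j l k 0 j *: z j) ->
  exists z' : 'I_n -> N, forall k, y k = \sum_j l k 0 j *: z' j.
Proof.
move=> sp kp ext ii iy.
have pl k : p (l k) = 0 by apply/kp/lspan_mem/map_f; rewrite mem_enum.
have [Q [q [sq kq]]] := cokernelP i.
have [||u uP] := @linear_descend _ _ M Q p (q \o combination z).
- by [].
- move=> x /kp; move: x; apply: lspan_min; first exact: submodule_ker.
  by move=> _ /mapP[k _ ->] /=; apply/kq; exists (y k).
have [|v vP] := Ext1_lift u ext (f := i) (g := q); first by split.
have [|w wP] := linear_corestrict ii (f := combination z \- (v \o p)).
  move=> x; have /kq[a aE] : q (combination z x - v (p x)) = 0.
    by rewrite linearB vP uP subrr.
  by exists a; rewrite aE.
exists (fun j => w (delta_mx 0 j)) => k.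
rewrite -(row_linear w); apply: ii; rewrite wP /= pl linear0 subr0.
exact: iy.
Qed.
End Extensions.

Section Presentation.
Variables (R : pzRingType) (D : lmodType int) (cogD : cogenerator D).
Variables (n m : nat) (l : 'I_m -> 'rV[R]_n).

(** The submodule A R^n of the right module R^m, where row k of A is [l k]. *)
Definition columns (y : 'rV[R^c]_m) : Prop :=
  exists z : 'I_n -> R, forall k, y 0 k = \sum_j l k 0 j * z j :> R.

Lemma columns_submodule : submodule columns.
Proof.
split.
  by exists (fun _ => 0) => k; rewrite mxE big1 // => j _; rewrite mulr0.
move=> r u v [z uz] [z' vz']; exists (fun j => z j * (r : R) + z' j) => k.
rewrite !mxE uz vz' -[r * _]/((\sum_j l k 0 j * z j) * (r : R)) mulr_suml
  -big_split.
by apply: eq_bigr => j _; rewrite /= mulrDr mulrA.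
Qed.

Variables (X : lmodType R^c) (q : {linear 'rV[R^c]_m -> X}).
Hypotheses (sq : forall x, exists y, q y = x)
           (kq : forall y, q y = 0 <-> columns y).

Notation Y := (char X D : lmodType R).

Lemma column_zero j : q (\row_k l k 0 j) = 0.
Proof.
apply/kq; exists (fun j' => (j' == j)%:R) => k.
rewrite mxE (bigD1 j) //= eqxx mulr1 big1 ?addr0 // => j' /negbTE->.
by rewrite mulr0.
Qed.

(** Maps from N to X^+, with X = R^m / A R^n, are the m-tuples of characters of N
    whose sum vanishes on A N^n. *)
Lemma char_presented (N : lmodType R) (phi : 'I_m -> {additive N -> D}) :
    (forall z : 'I_n -> N, \sum_k phi k (\sum_j l k 0 j *: z j) = 0) ->
  exists theta : {linear N -> Y},
    forall w x, ev (theta w) (q x) = \sum_k phi k ((x 0 k : R) *: w).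
Proof.
move=> phi0.
apply: (@linear_of_rel _ N Y (fun w c =>
  forall x, ev c (q x) = \sum_k phi k ((x 0 k : R) *: w))).
- move=> w.
  have psiB : zmod_morphism (fun x : 'rV[R^c]_m => \sum_k phi k ((x 0 k : R) *:
    w)).
    move=> x x'; rewrite -sumrB; apply: eq_bigr => k _.
    by rewrite !mxE scalerBl raddfB.
  have qB : zmod_morphism q by exact: raddfB.
  have [x|g gP] :=
      character_extend cogD (u := additive_of qB) (f := additive_of psiB).
    move=> /kq[z xz] /=; rewrite -[RHS](phi0 (fun j => z j *: w)).
    apply: eq_bigr => k _; rewrite xz scaler_suml; congr (phi k _).
    by apply: eq_bigr => j _; rewrite scalerA.
  by exists (Char g) => x; rewrite CharE; exact: gP.
- by move=> w c c' cP c'P; apply: char_ext => x; have [y <-] := sq x;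
  rewrite cP c'P.
- move=> r w w' c c' cP c'P x; rewrite evD evZ -linearZ cP c'P -big_split.
  apply: eq_bigr => k _ /=; rewrite scalerDr raddfD mxE scalerA.
  by [].
Qed.

Lemma presented_ev (N : lmodType R) (theta : {linear N -> Y}) w x :
  ev (theta w) (q x) = \sum_k ev (theta ((x 0 k : R) *: w)) (q (delta_mx 0 k)).
Proof.
rewrite {1}[x]row_sum_delta linear_sum raddf_sum; apply: eq_bigr => k _.
by rewrite [theta (_ *: w)]linearZ evZ linearZ.
Qed.

(** The rows of A lie in L^m and form A z, for z the standard basis of R^n.  If
    they were not in A L^n, a character of L^m would separate them from it and
    give a map L -> X^+; its extension to R^n would vanish on this A z.  The
    vector in L^n that solves the system is the retraction of R^n onto L. *)
Lemma presented_injective_split : injective_module Y ->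
  exists rho : {linear 'rV[R]_n -> 'rV[R]_n},
    (forall u, lspan (map l (enum 'I_m)) (rho u)) /\
    (forall u, lspan (map l (enum 'I_m)) u -> rho u = u).
Proof.
move=> injY.
have [W [i [ii iP]]] := submodule_typeP (lspan_submodule (map l (enum 'I_m))).
have /choice[y yP] k : exists w, i w = l k.
  by apply/iP/lspan_mem/map_f; rewrite mem_enum.
suff [z zP] : exists z : 'I_n -> W, forall k, y k = \sum_j l k 0 j *: z j.
  exists (i \o combination z); split=> [u|]; first by apply/iP;
    exists (combination z u).
  apply: (lspan_min (S := fun u => (i \o combination z) u = u)).
    by split; [rewrite linear0|move=> r u v ru rv; rewrite [LHS]linearP;
      congr (_ *: _ + _)].
  by move=> _ /mapP[k _ ->]; rewrite -[in RHS]yP zP.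
apply: contrapT => none.
have [z zP|phi [phi0 /eqP phiy]] :=
  @unsolvable_character R D cogD m n (fun k => l k 0) W y.
  by apply: none; exists z.
have [theta thetaP] := char_presented phi0.
have [theta' theta'P] := injY _ _ i theta ii.
apply: phiy.
have -> : \sum_k phi k (y k) = \sum_k ev (theta (y k)) (q (delta_mx 0 k)).
  apply: eq_bigr => k _; rewrite thetaP (bigD1 k) //= mxE !eqxx scale1r.
  by rewrite big1 ?addr0 // => k' k'k;
    rewrite mxE eqxx (negbTE k'k) scale0r raddf0.
under eq_bigr => k _ do rewrite -theta'P yP row_linear ev_sum.
rewrite exchange_big big1 // => j _ /=.
have := presented_ev theta' (delta_mx 0 j) (\row_k l k 0 j).
rewrite column_zero raddf0 => /esym; apply: etrans.
by apply: eq_bigr => k _; rewrite mxE linearZ.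
Qed.

Variables (M : lmodType R) (p : {linear 'rV[R]_n -> M}).
Hypotheses (sp : forall w, exists u, p u = w)
           (kp : forall u, p u = 0 <-> lspan (map l (enum 'I_m)) u).

Lemma presented_injective_projective : injective_module Y -> projective_module M.
Proof.
move=> /presented_injective_split[rho [rhoS rhoE]] A B f g sf.
have /choice[e eP] j : exists a, f a = g (p (delta_mx 0 j)) by apply: sf.
have [||h hP] := @linear_descend _ _ M A p (combination e \o (idfun \- rho)).
- exact: sp.
- move=> u /kp/rhoE ru; rewrite -[LHS]/(combination e (u - rho u)) ru subrr.
  exact: linear0.
exists h => w; have [u <-] := sp w; rewrite hP.
set v := u - rho u; rewrite -[_ u]/(combination e v).
have -> : p u = p v by rewrite /v linearB (_ : p (rho u) = 0) ?subr0 //; apply/kp.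
rewrite -[RHS]/((g \o p) v) -[LHS]/((f \o combination e) v).
rewrite (row_linear (g \o p)) (row_linear (f \o combination e)).
apply: eq_bigr => j _; congr (_ *: _).
by rewrite -[LHS]/(f (combination e _)) combination_delta eP.
Qed.

(** By [Ext1_system], A K^n meets N^m in A N^n, so a character of N^m killing
    A N^n extends to one of K^m killing A K^n. *)
Lemma presented_subinjective (N : lmodType R) : Ext1_eq0 M N -> subinjective Y N.
Proof.
move=> ext K i theta ii.
have phiB k : zmod_morphism (fun w : N => ev (theta w) (q (delta_mx 0 k))).
  by move=> w w'; rewrite raddfB.
pose phi k := additive_of (phiB k).
have thetaP w x : ev (theta w) (q x) = \sum_k phi k ((x 0 k : R) *: w).
  exact: presented_ev.
have phi0 (z : 'I_n -> N) : \sum_k phi k (\sum_j l k 0 j *: z j) = 0.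
  under eq_bigr => k _ do rewrite raddf_sum.
  rewrite exchange_big big1 // => j _ /=.
  have := thetaP (z j) (\row_k l k 0 j).
  rewrite column_zero raddf0 => /esym; apply: etrans.
  by apply: eq_bigr => k _; rewrite mxE.
(* Extending along (y, z) |-> i y - A z, on whose kernel phi y vanishes, replaces
   a passage to the quotient K^m / A K^n. *)
pose u (yz : {ffun 'I_m -> N} * {ffun 'I_n -> K}) : {ffun 'I_m -> K} :=
  [ffun k => i (yz.1 k) - \sum_j l k 0 j *: yz.2 j].
have uB : zmod_morphism u.
  move=> [y z] [y' z']; apply/ffunP => k; rewrite !ffunE /= ?ffunE linearB.
  have -> : \sum_j l k 0 j *: (z - z') j =
            \sum_j l k 0 j *: z j - \sum_j l k 0 j *: z' j.
    by rewrite -sumrB; apply: eq_bigr => j _; rewrite !ffunE scalerBr.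
  by rewrite !opprB addrACA [RHS]addrACA [X in _ + X = _]addrC.
have fB : zmod_morphism
    (fun yz : {ffun 'I_m -> N} * {ffun 'I_n -> K} => \sum_k phi k (yz.1 k)).
  by move=> yz yz'; rewrite -sumrB; apply: eq_bigr => k _; rewrite !ffunE -raddfB.
have [[y z] /= /ffunP uyz|G GP] :=
    character_extend cogD (u := additive_of uB) (f := additive_of fB).
  have [|z' z'P] := Ext1_system (y := y) (z := z) sp kp ext ii.
    by move=> k; apply/eqP; rewrite -subr_eq0; have := uyz k;
      rewrite !ffunE /= => ->.
  by rewrite -[RHS](phi0 z'); apply: eq_bigr => k _; rewrite z'P.
have [psi [Gsum psiE]] := additive_coordinates G.
have psi_i k x : psi k (i x) = phi k x.
  have := GP ([ffun k' => if k' == k then x else 0], 0) => /=.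
  rewrite (bigD1 k) //= ffunE eqxx big1 ?addr0 => [<-|k' /negbTE k'k]; last first.
    by rewrite ffunE k'k raddf0.
  rewrite psiE; congr (G _); apply/ffunP => k'; rewrite !ffunE /= ?ffunE.
  rewrite big1 ?subr0 => [|j _]; last by rewrite ffunE scaler0.
  by case: eqP; rewrite ?linear0.
have psi0 (z : 'I_n -> K) : \sum_k psi k (\sum_j l k 0 j *: z j) = 0.
  have := GP (0, [ffun j => - z j]) => /=.
  rewrite [RHS]big1 => [|k _]; last by rewrite ffunE raddf0.
  apply: etrans; rewrite [RHS]Gsum; apply: eq_bigr => k _; congr (psi k _).
  rewrite !ffunE /= ?ffunE linear0 sub0r -sumrN; apply: eq_bigr => j _.
  by rewrite ffunE scalerN opprK.
have [h hP] := char_presented psi0; exists h => w; apply: char_ext => x.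
have [y <-] := sq x; rewrite hP thetaP; apply: eq_bigr => k _.
by rewrite -linearZ psi_i.
Qed.
End Presentation.

Section FinitelyGenerated.
Variable R : pzRingType.
Hypotheses (noeth : left_noetherian R)
  (dichotomy : forall M : lmodType R,
     pure_injective M -> injective_module M \/ pi_indigent M).

Lemma fg_nonprojective_i_test (M : lmodType R) :
  finitely_generated M -> ~ projective_module M -> i_test M.
Proof.
move=> [n [e eP]] nproj.
have [D cogD] := exists_cogenerator.
pose p := combination e.
have sp w : exists u, p u = w.
  have [a ->] := eP w; exists (\row_i a i).
  by apply: eq_bigr => i _; rewrite mxE.
have [t tP] := lspan_row R n.
have [s kp] :=
  noetherian_lspan (s := t) noeth (submodule_ker p) (fun v _ => tP v).
pose l k := tnth (in_tuple s) k.
have kpl u : p u = 0 <-> lspan (map l (enum 'I_(size s))) u.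
  by rewrite (map_tnth_enum (in_tuple s)) -kp.
have [X [q [sq kq]]] := quotient_moduleP (columns_submodule l).
have [injY|[_ indY] N ext] := dichotomy (@char_pure_injective R X D cogD).
  by case: nproj; exact: (presented_injective_projective cogD sq kq sp kpl injY).
apply: (absolutely_pure_injective cogD noeth); apply/indY.
exact: (presented_subinjective cogD sq kq sp kpl ext).
Qed.
End FinitelyGenerated.

(** * From a module to its submodules *)

Section Hereditary.
Variable R : pzRingType.
Implicit Types M N E Q S : lmodType R.

(** Q is the direct sum of C and of the kernel K of the retraction tau. *)
Lemma injective_extension (C K Q : lmodType R) (j : {linear C -> Q})
    (tau : {linear Q -> C}) (kappa : {linear K -> Q}) :
    injective_module C -> injective_module K ->
    (forall c, tau (j c) = c) -> injective kappa ->
    (forall x, tau x = 0 -> exists k, kappa k = x) ->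
  injective_module Q.
Proof.
move=> injC injK tauj kappaI ktau A B i f ii.
have [h1 h1P] := injC _ _ i (tau \o f) ii.
have [a|f2 f2P] := linear_corestrict kappaI (f := f \- (j \o (tau \o f))).
  by apply: ktau; rewrite /= linearB tauj subrr.
have [h2 h2P] := injK _ _ i f2 ii.
exists ((j \o h1) \+ (kappa \o h2)) => a /=.
by rewrite h1P h2P f2P /= addrCA subrr addr0.
Qed.

Lemma Ext1_eq0_retraction M N :
    (forall E (f : {linear N -> E}) (g : {linear E -> M}), short_exact f g ->
       exists rho : {linear E -> N}, forall n, rho (f n) = n) ->
  Ext1_eq0 M N.
Proof.
move=> retr E f g fg; have [rho rhoP] := retr E f g fg.
have [fi kg sg] := fg.
have phiL : linear (fun e => (rho e, g e)).
  by move=> r e e'; rewrite !linearP.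
exists (linear_of phiL); split=> [|n|e] //=; last first.
  by rewrite rhoP; congr pair; apply/kg; exists n.
have /choice[psi psiP] (y : N * M) : exists e, (rho e, g e) = y.
  case: y => n m; have [e <-] := sg m; exists (e + f (n - rho e)).
  rewrite (linearD rho) (linearD g) rhoP addrCA subrr addr0; congr pair.
  suff -> : g (f (n - rho e)) = 0 by rewrite addr0.
  by apply/kg; exists (n - rho e).
exists psi => [e|y]; last exact: psiP.
have [r1 g1] := psiP (rho e, g e).
apply/eqP; rewrite -subr_eq0; apply/eqP.
have /kg[n nE] : g (psi (rho e, g e) - e) = 0 by rewrite linearB g1 subrr.
by rewrite -nE -[n]rhoP nE linearB r1 subrr linear0.
Qed.

(** N is the direct sum of N1 and the kernel K of pi; an extension E of M by N1
    gives the extension E x K of M by N, and a splitting of E x K splits E. *)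
Lemma Ext1_eq0_retract M N N1 (kappa : {linear N1 -> N}) (pi : {linear N -> N1}) :
    (forall x, pi (kappa x) = x) -> Ext1_eq0 M N -> Ext1_eq0 M N1.
Proof.
move=> pik ext; apply: Ext1_eq0_retraction => E f g [fi kg sg].
have [K [z [zi zP]]] := submodule_typeP (submodule_ker pi).
have [n|tau tauP] := linear_corestrict zi (f := idfun \- (kappa \o pi)).
  by apply/zP; rewrite /= linearB pik subrr.
have f'L : linear (fun n => (f (pi n), tau n)).
  by move=> r n n'; rewrite !linearP.
have piz k : pi (z k) = 0 by apply/zP; exists k.
have tauz k : tau (z k) = k by apply: zi; rewrite tauP /= piz linear0 subr0.
have tauk x : tau (kappa x) = 0 by apply: zi; rewrite tauP /= pik subrr linear0.
have [|v vP] := Ext1_lift (f := linear_of f'L)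
    (g := g \o (fst : {linear (E * K)%type -> E}))
    (idfun : {linear M -> M}) ext.
  split.
  - move=> n n' /= [/fi pnn' tnn'].
    have dec x : x = kappa (pi x) + z (tau x) by rewrite tauP /= addrCA subrr
      addr0.
    by rewrite [n]dec [n']dec pnn' tnn'.
  - move=> [e k]; split=> [/kg[x xe]|[n [<- _]] /=]; last by apply/kg;
    exists (pi n).
    exists (kappa x + z k); congr pair => /=.
      by rewrite linearD pik piz addr0.
    by rewrite linearD tauk tauz add0r.
  - by move=> m; have [e <-] := sg m; exists (e, 0).
have [e|rho rhoP] := linear_corestrict fi
    (f := idfun \- ((fst : {linear (E * K)%type -> E}) \o (v \o g))).
  by apply/kg; rewrite /= linearB; have /= -> := vP (g e); rewrite subrr.
exists rho => n; apply: fi; rewrite rhoP /=.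
have /kg -> : exists a, f a = f n by exists n.
by rewrite linear0 subr0.
Qed.

Section EnoughInjectives.
Variables (D : lmodType int) (cogD : cogenerator D).

Definition coregular : lmodType R := char (R^c)^o D.

(** A linear map to R^+ is determined by the additive map obtained by evaluation
    at 1, and these extend. *)
Lemma coregular_injective : injective_module coregular.
Proof.
move=> A B i f ii.
have f1B : zmod_morphism (fun a => ev (f a) 1).
  by move=> a a'; rewrite -[LHS]/(ev (f (a - a')) 1) linearB.
have iB : zmod_morphism i by exact: raddfB.
have [a|g gP] :=
    character_extend cogD (u := additive_of iB) (f := additive_of f1B).
  by rewrite /= -(linear0 i) => /ii->; rewrite linear0.
have hB b : zmod_morphism (fun x : R => g (x *: b)).
  by move=> x y; rewrite scalerBl raddfB.
have hL : linear (fun b =>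
    Char (additive_of (hB b) : {additive (R^c)^o -> D}) : coregular).
  move=> r b b'; apply: char_ext => x.
  rewrite evD evZ !CharE /= scalerDr raddfD scalerA.
  by [].
exists (linear_of hL) => a; apply: char_ext => x.
rewrite -[LHS]/(g ((x : R) *: i a)) -linearZ -[LHS]/(g (additive_of iB _)) gP /=.
rewrite linearZ evZ; congr (ev _ _); exact: (mulr1 (x : R^c)).
Qed.

(** N embeds into a power of R^+, with one factor for each character of N. *)
Lemma enough_injectives N :
  exists E (i : {linear N -> E}), injective i /\ injective_module E.
Proof.
pose J : Type := {additive N -> D}.
have cB (g : J) (n : N) : zmod_morphism (fun x : R => g (x *: n)).
  by move=> x y; rewrite scalerBl raddfB.
pose c n (g : J) : coregular :=
  Char (additive_of (cB g n) : {additive (R^c)^o -> D}).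
have cL : linear (c : N -> (J -> coregular)).
  move=> r n n'; apply/funext => g; apply: char_ext => x.
  rewrite -[RHS]/(ev (r *: c n g + c n' g) x) evD evZ !CharE /= scalerDr raddfD
    scalerA.
  by [].
exists (J -> coregular : lmodType R), (linear_of cL); split.
  move=> n n' /= nn'; apply/eqP; rewrite -subr_eq0; apply/eqP;
    apply: contrapT => /eqP d0.
  have [phi /eqP] := cogD.2 (zmodule N) (n - n') d0; apply.
  have phiB : zmod_morphism (phi : N -> D) by exact: (raddfB phi).
  have : phi ((1 : R) *: n : N) = phi ((1 : R) *: n' : N).
    exact: (congr1 (fun d : J ->
      coregular => ev (d (additive_of phiB)) (1 : R)) nn').
  rewrite !scale1r => e; apply: etrans (raddfB phi n n') _.
  by apply/eqP; rewrite subr_eq0; apply/eqP.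
move=> A B i f ii.
have ext (g : J) : exists h : {linear B -> coregular}, forall a, h (i a) = f a g.
  have fL : linear (fun a => f a g) by move=> r a a'; rewrite linearP.
  exact: (coregular_injective (linear_of fL) ii).
have [h hP] := choice ext.
have hL : linear (fun b => (fun g => h g b) : J -> coregular).
  by move=> r b b'; apply/funext => g; rewrite linearP.
by exists (linear_of hL) => a; apply/funext => g /=; rewrite hP.
Qed.
End EnoughInjectives.

Hypothesis SI : forall N, (forall x : N, singular x) -> injective_module N.

Definition nonsingular_module N : Prop := forall x : N, singular x -> x = 0.

(** Let C be a complement of N in E.  It is injective: if I is essential and
    I e is in C, then e is in C, since otherwise c + r e would be a nonzero
    element of N for some c in C, killed by the essential ideal of the t with
    t r in I, although N is nonsingular.  So the image of C splits off E / N.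
    The other summand is singular, because C + N is essential in E. *)
Lemma quotient_injective N E Q (i : {linear N -> E}) (q : {linear E -> Q}) :
    nonsingular_module N -> injective_module E -> short_exact i q ->
  injective_module Q.
Proof.
move=> nsN injE [ii kq sq].
have subN := submodule_range i; set imN := (fun y => _) in subN.
have sub0 := submodule_ker (idfun : {linear E -> E}).
have [|C [subC _ disC maxC]] := maximal_disjoint subN sub0 => //.
have [W [c [ci cP]]] := submodule_typeP subC.
have Cc w : C (c w) by apply/cP; exists w.
have qi n : q (i n) = 0 by apply/kq; exists n.
have injW : injective_module W.
  apply: baer => I h essI hP; have [subI _] := essI.
  have [V [k [ki kP]]] := submodule_typeP subI.
  have Ik v : I (k v) by apply/kP; exists v.
  have hkL : linear (fun v => c (h (k v))).
    by move=> r v v'; rewrite -[RHS]linearP -hP // linearP.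
  have [g gP] := injE _ _ k (linear_of hkL) ki.
  pose e := g 1.
  have eP a : I a -> c (h a) = a *: e.
    by move=> /kP[v <-]; rewrite -[LHS]gP -linearZ; congr (g _); apply/esym/mulr1.
  have [/cP[w we]|/maxC[r [s [Cs [n sn]]]]] := pselect (C e).
    by exists w => a Ia; apply: ci; rewrite eP // -we linearZ.
  case/eqP; rewrite -sn (nsN n) ?linear0 //; apply: (singular_inj ii).
  apply: ess_sub (ess_colon (r : R^o) essI);
    first exact: (submodule_ker (scale_by (i n))).
  move=> t It; apply: disC; last by exists ((t : R) *: n); rewrite linearZZ.
  rewrite sn scalerDr scalerA -eP //.
  by apply: (submoduleD subC) => //; apply: (submoduleZ subC).
have qci : injective (q \o c).
  move=> w w' /eqP; rewrite -subr_eq0 -linearB => /eqP/kq[n nE].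
  apply: ci; apply/eqP; rewrite -subr_eq0 -linearB; apply/eqP/disC => //.
  by exists n.
have [tau tauP] :=
  injW _ _ (q \o c : {linear W -> Q}) (idfun : {linear W -> W}) qci.
have [K [kappa [ki kP]]] := submodule_typeP (submodule_ker tau).
apply: (@injective_extension W K Q (q \o c) tau kappa injW _ tauP ki); last first.
  by move=> x /kP.
apply: SI => x; have [e eE] := sq (kappa x).
apply: ess_sub (ess_colon e (complement_ess subN subC disC maxC)).
  exact: (submodule_ker (scale_by x)).
suff rx0 (r : R) w n : r *: e = c w + i n -> r *: x = 0.
  by move=> r [_ [_ [/cP[w <-] [n <-] re]]]; exact: rx0 re.
move=> re; apply: ki.
have qw : kappa (r *: x) = q (c w).
  by rewrite linearZ -eE -linearZ re linearD qi addr0.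
have w0 : w = 0.
  by have := tauP w; rewrite /= -qw => <-; apply/kP; exists (r *: x).
by rewrite qw w0 !linear0.
Qed.

(** Embed N in an injective H.  The extension is the pullback of H -> H / N along
    a map b : S -> H / N, which extends to M as H / N is injective, and there
    lifts to H. *)
Lemma Ext1_eq0_submodule M N S (sigma : {linear S -> M}) :
    nonsingular_module N -> injective sigma -> Ext1_eq0 M N -> Ext1_eq0 S N.
Proof.
move=> nsN sigi ext; apply: Ext1_eq0_retraction => E f g [fi kg sg].
have [D cogD] := exists_cogenerator.
have [H [i [ii injH]]] := enough_injectives cogD N.
have [Q [q [sq kq]]] := cokernelP i.
have iq : short_exact i q by split.
have injQ := quotient_injective nsN injH iq.
have [a aP] := injH _ _ f i fi.
have [||b bP] := @linear_descend _ E S Q g (q \o a).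
- exact: sg.
- by move=> e /kg[n <-]; rewrite /= aP; apply/kq; exists n.
have [u uP] := injQ _ _ sigma b sigi.
have [v vP] := Ext1_lift u ext iq.
have [e|rho rhoP] := linear_corestrict ii (f := a \- (v \o (sigma \o g))).
  have /kq[n nE] : q (a e - v (sigma (g e))) = 0.
    by rewrite linearB vP uP bP subrr.
  by exists n; rewrite nE.
exists rho => n; apply: ii; rewrite rhoP /= aP.
have -> : g (f n) = 0 by apply/kg; exists n.
by rewrite (linear0 sigma) (linear0 v) subr0.
Qed.

(** N is the sum of its singular submodule Z, which is injective, and of a
    nonsingular module N1, to which [Ext1_eq0_submodule] applies. *)
Lemma i_test_of_submodule M S (sigma : {linear S -> M}) :
  injective sigma -> i_test S -> i_test M.
Proof.
move=> sigi testS N ext.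
have [Z [z [zi zP]]] := submodule_typeP (singular_submodule N).
have injZ : injective_module Z.
  by apply: SI => x; apply: (singular_inj zi); apply/zP; exists x.
have [tau tauP] := injZ _ _ z (idfun : {linear Z -> Z}) zi.
have [N1 [kappa [ki kP]]] := submodule_typeP (submodule_ker tau).
have [n|pi piP] := linear_corestrict ki (f := idfun \- (z \o tau)).
  by apply/kP; rewrite /= linearB tauP subrr.
have tauk x : tau (kappa x) = 0 by apply/kP; exists x.
have pik x : pi (kappa x) = x by apply: ki; rewrite piP /= tauk linear0 subr0.
have nsN1 : nonsingular_module N1.
  move=> x /(singular_im kappa)/zP[w wx]; apply: ki.
  by rewrite -wx -[w]tauP wx tauk !linear0.
apply: (injective_extension injZ _ tauP ki); last by move=> x /kP.
apply: testS; apply: Ext1_eq0_submodule nsN1 sigi _.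
exact: Ext1_eq0_retract pik ext.
Qed.
End Hereditary.

(** * Flatness *)

Section Flatness.
Variable R : pzRingType.

Lemma tensBl (X : lmodType R^c) (A : lmodType R) (x x' : X) (a : A) :
  tens (x - x') a = tens x a - tens x' a.
Proof. by apply: (addIr (tens x' a)); rewrite -tensDl !subrK. Qed.

Lemma tens0l (X : lmodType R^c) (A : lmodType R) (a : A) : tens (0 : X) a = 0.
Proof. by rewrite -(subrr 0) tensBl subrr. Qed.

Variables (D : lmodType int) (cogD : cogenerator D).
Variables (M : lmodType R) (A B C : lmodType R^c).
Variables (f : {linear A -> B}) (g : {linear B -> C}).
Hypothesis fg : short_exact f g.

Definition tensor_id (X Y : lmodType R^c) (h : {linear X -> Y}) :
    {additive tensor X M -> tensor Y M} :=
  additive_of (tensor_map_is_zmod_morphism h (idfun : {linear M -> M})).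

Lemma tensor_idE (X Y : lmodType R^c) (h : {linear X -> Y}) x m :
  tensor_id h (tens x m) = tens (h x) m.
Proof. exact: (tensor_mapE h (idfun : {linear M -> M})). Qed.

Lemma tensor_id_surjective c : exists b, tensor_id g b = c.
Proof.
have [_ _ sg] := fg; elim/tensor_ind: c => [|s t [b <-] [b' <-]|c m].
- by exists 0; rewrite raddf0.
- by exists (b - b'); rewrite raddfB.
- by have [b <-] := sg c; exists (tens b m); rewrite tensor_idE.
Qed.

(** If b were not in the image of A (x) M, some character of B (x) M would kill
    this image but not b.  It factors through C (x) M, where b becomes 0. *)
Lemma tensor_id_exact b : tensor_id g b = 0 <-> exists a, tensor_id f a = b.
Proof.
have [_ kg sg] := fg; split=> [gb|[a <-]]; last first.
  elim/tensor_ind: a => [|s t fs ft|a m]; first by rewrite !raddf0.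
    by rewrite !raddfB fs ft subrr.
  rewrite !tensor_idE.
  have -> : g (f a) = 0 by apply/kg; exists a.
  exact: tens0l.
apply: contrapT => nb.
have [a fa|phi [phif /eqP phib]] :=
    character_separate cogD (u := tensor_id f) (b := b).
  by apply: nb; exists a.
apply: phib.
have /choice[s sE] := sg.
have phi_fib x x' m : g x = g x' -> phi (tens x m) = phi (tens x' m).
  move=> gx; apply/eqP; rewrite -subr_eq0 -raddfB -tensBl.
  have /kg[a <-] : g (x - x') = 0 by rewrite linearB gx subrr.
  by rewrite -tensor_idE phif.
have [|psi psiE] := @tensor_lift _ C M D (fun c m => phi (tens (s c) m)).
  split=> [c c' m|c m m'|c r m].
  - by rewrite -raddfD -tensDl; apply: phi_fib; rewrite raddfD /= !sE.
  - by rewrite tensDr raddfD.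
  - by rewrite -tens_bal; apply: phi_fib; rewrite linearZ /= !sE.
have psig : zmod_morphism (fun t => psi (tensor_id g t)).
  by move=> x y; rewrite !raddfB.
have -> : phi b = psi (tensor_id g b).
  apply: (tensor_add_ext (g := additive_of psig)) => x m.
  rewrite -[RHS]/(psi (tensor_id g _)) tensor_idE psiE.
  by apply: phi_fib; rewrite sE.
by rewrite gb raddf0.
Qed.

Definition balanced_on (S : set M) (X : lmodType R^c)
    (psi : X -> M -> D) : Prop :=
  [/\ forall b b' m, S m -> psi (b + b') m = psi b m + psi b' m,
      forall b m m', S m -> S m' -> psi b (m + m') = psi b m + psi b m' &
      forall b (r : R) m, S m -> psi ((r : R^c) *: b) m = psi b (r *: m)].

Definition free_eval (X : lmodType R^c) (psi : X -> M -> D) :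
  {freeg (X * M) / int} -> D := fglift (fun p => psi p.1 p.2).

Lemma free_evalB X psi s t :
  @free_eval X psi (s - t) = free_eval psi s - free_eval psi t.
Proof. exact: lift_is_additive. Qed.

Lemma free_evalU X psi x m : @free_eval X psi << (x, m) >> = psi x m.
Proof. by rewrite /free_eval liftU scale1r. Qed.

Lemma free_eval0 X psi : @free_eval X psi 0 = 0.
Proof. by rewrite -(subrr 0) free_evalB subrr. Qed.

(** A vanishing tensor vanishes for reasons that involve finitely many elements
    of M, namely those in the relators used. *)
Lemma tensor_null_finite (X : lmodType R^c) t : t \in @tensor_null R X M ->
  exists l : seq M, forall psi : X -> M -> D,
    balanced_on (lspan l) psi -> free_eval psi t = 0.
Proof.
move=> /asboolP nt.
pose S : {pred {freeg (X * M) / int}} := fun t => `[< exists l : seq M,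
  forall psi : X -> M -> D, balanced_on (lspan l) psi -> free_eval psi t = 0 >].
apply/asboolP/(nt S).
  split; first by apply/asboolP; exists [::] => psi _; exact: free_eval0.
  move=> s u /asboolP[l hl] /asboolP[l' hl']; apply/asboolP; exists (l ++ l').
  have sub_on k psi : (forall x, x \in k -> x \in l ++ l') ->
      balanced_on (lspan (l ++ l')) psi -> balanced_on (lspan k) psi.
    move=> kl [h1 h2 h3]; have kS := lspan_sub kl.
    by split=> *; [apply: h1|apply: h2|apply: h3]; apply: kS.
  move=> psi on; rewrite free_evalB hl ?hl' ?subrr //.
    by apply: sub_on on => x xl; rewrite mem_cat xl orbT.
  by apply: sub_on on => x xl; rewrite mem_cat xl.
move=> s [b b' m|b m m'|b r m]; apply/asboolP.
- exists [:: m] => psi [h1 _ _]; rewrite !free_evalB !free_evalU h1.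
    by rewrite -addrA -opprD subrr.
  by apply: lspan_mem; rewrite inE.
- exists [:: m; m'] => psi [_ h2 _]; rewrite !free_evalB !free_evalU h2.
  + by rewrite -addrA -opprD subrr.
  + by apply: lspan_mem; rewrite inE eqxx.
  + by apply: lspan_mem; rewrite !inE eqxx orbT.
- exists [:: m] => psi [_ _ h3]; rewrite !free_evalB !free_evalU h3 ?subrr //.
  by apply: lspan_mem; rewrite inE.
Qed.

Lemma free_eval_support (X : lmodType R^c) t :
  exists l : seq M, forall psi psi' : X -> M -> D,
    (forall x m, lspan l m -> psi x m = psi' x m) ->
      free_eval psi t = free_eval psi' t.
Proof.
elim/freeg_int_ind: t => [|s t [l hl] [l' hl']|[x m]].
- by exists [::] => psi psi' _; rewrite !free_eval0.
- exists (l ++ l') => psi psi' agree; rewrite !free_evalB.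
  by rewrite (hl psi psi') ?(hl' psi psi') // => x m lm;
    apply: agree; apply: lspan_sub lm => y yl; rewrite mem_cat yl ?orbT.
- exists [:: m] => psi psi' agree; rewrite !free_evalU; apply: agree.
  by apply: lspan_mem; rewrite inE.
Qed.

(** Suppose that t is not 0 but becomes 0 in B (x) M.  Let phi be a character of
    A (x) M with phi t <> 0, and S a finitely generated submodule of M that
    contains the elements of M in t and those in the relations that make t vanish
    in B (x) M.  On S, phi is a map S -> A^+; as B^+ -> A^+ is surjective and S is
    projective, it lifts to B^+.  This is a balanced map on B x S, which takes
    the value phi t on t but is 0 by the choice of S. *)
Lemma tensor_id_injective :
    (forall (S : lmodType R) (sigma : {linear S -> M}),
       injective sigma -> finitely_generated S -> projective_module S) ->
  injective (tensor_id f).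
Proof.
move=> fgproj; have [fi _ _] := fg.
suff ker0 t : tensor_id f t = 0 -> t = 0.
  move=> s t st; apply/eqP; rewrite -subr_eq0; apply/eqP/ker0.
  by rewrite raddfB st subrr.
move=> ft; apply: contrapT => /eqP t0.
have [phi0 phi0t] := cogD.2 (zmodule (tensor A M)) t t0.
have phiB : zmod_morphism (phi0 : tensor A M -> D) by exact: (raddfB phi0).
pose phi := additive_of phiB.
have /eqP phit : phi t != 0 by [].
pose u := repr t; have tE : t = \pi_(tensor A M) u by rewrite reprK.
have phiu w : phi (\pi_(tensor A M) w) = free_eval (fun a m => phi (tens a m)) w.
  elim/freeg_int_ind: w => [|s w Es Ew|[a m]].
  - by rewrite free_eval0 -(subrr 0) tens_pi_is_zmod_morphism subrr raddf0.
  - by rewrite free_evalB -Es -Ew tens_pi_is_zmod_morphism raddfB.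
  - by rewrite free_evalU.
have [|l lP] := @tensor_null_finite B (tensor_free_map f (@idfun M) u).
  have := ft; rewrite tE /= (tensor_map_pi f (idfun : {linear M -> M})).
  rewrite -(subrr (\pi_(tensor B M) 0)) -tens_pi_is_zmod_morphism subrr.
  by move/tensor_piP; rewrite subr0.
have [l' l'P] := @free_eval_support A u.
pose T := lspan (l ++ l').
have [S [sigma [sigi sP]]] := submodule_typeP (lspan_submodule (l ++ l')).
have fgS : finitely_generated S.
  have /choice[e eP] : forall k : 'I_(size (l ++ l')), exists w,
    sigma w = tnth (in_tuple (l ++ l')) k.
    by move=> k; apply/sP/lspan_mem/mem_tnth.
  exists (size (l ++ l')), e => w.
  pose I (x : M) := exists a : 'I_(size (l ++ l')) -> R,
    x = \sum_i a i *: sigma (e i).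
  have [a aE] : I (sigma w).
    have : T (sigma w) by apply/sP; exists w.
    apply: lspan_min.
      split; first by exists (fun _ => 0); rewrite big1 // => i _;
        rewrite scale0r.
      move=> r _ _ [a ->] [b ->]; exists (fun i => r * a i + b i).
      rewrite scaler_sumr -big_split; apply: eq_bigr => i _.
      by rewrite /= scalerDl scalerA.
    move=> _ /(tnthP (in_tuple (l ++ l')))[k ->]; exists (fun i => (i == k)%:R).
    by rewrite (bigD1 k) //= eqxx scale1r eP big1 ?addr0 // => i /negbTE->;
      rewrite scale0r.
  exists a; apply: sigi; rewrite aE linear_sum.
  by apply: eq_bigr => i _; rewrite linearZ.
have projS := fgproj S sigma sigi fgS.
have chiB w : zmod_morphism (fun a : A => phi (tens a (sigma w))).
  by move=> a a'; rewrite tensBl raddfB.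
have chiL : linear (fun w => Char (additive_of (chiB w))).
  move=> r w w'; apply: char_ext => a.
  by rewrite evD evZ !CharE /= linearP tensDr raddfD tens_bal.
have resB (c : char B D) : zmod_morphism (fun a : A => ev c (f a)).
  by move=> a a'; rewrite raddfB /= raddfB.
have resL : linear (fun c => Char (additive_of (resB c))).
  move=> r c c'; apply: char_ext => a.
  by rewrite evD evZ !CharE /= evD evZ linearZ.
have fB : zmod_morphism f by exact: raddfB.
have [c|theta thetaP] := projS _ _ (linear_of resL) (linear_of chiL).
  have [a|d dP] := character_extend cogD (u := additive_of fB) (f := ev c).
    by move=> /= fa0; rewrite (_ : a = 0) ?raddf0 //; apply: fi;
      rewrite fa0 raddf0.
  by exists (Char d); apply: char_ext => a; exact: dP.
have theta_f w a : ev (theta w) (f a) = phi (tens a (sigma w)).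
  exact: (congr1 (fun c : char A D => ev c a) (thetaP w)).
have /choice[back backP] : forall m, exists w, T m -> sigma w = m.
  move=> m; have [/sP[w <-]|nT] := pselect (T m); first by exists w.
  by exists 0.
pose psi b m := ev (theta (back m)) b.
have subT : submodule T by apply: lspan_submodule.
have psi_on : balanced_on T psi.
  split=> [b b' m _|b m m' Tm Tm'|b r m Tm]; rewrite /psi ?raddfD //.
    rewrite -evD -linearD; congr (ev (theta _) b); apply: sigi.
    by rewrite linearD !backP //; apply: (submoduleD subT).
  rewrite -evZ -linearZ; congr (ev (theta _) b); apply: sigi.
  by rewrite linearZ /= !backP //; apply: (submoduleZ subT).
apply: phit; rewrite tE phiu.
rewrite (l'P _ (fun a m => psi (f a) m)) => [|a m lm]; last first.
  rewrite /psi theta_f backP //.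
  by apply: lspan_sub lm => y yl; rewrite mem_cat yl orbT.
have -> w : free_eval (fun a m => psi (f a) m) w = free_eval psi
  (tensor_free_map f (@idfun M) w).
  elim/freeg_int_ind: w => [|s w Es Ew|[a m]].
  - have -> : tensor_free_map f (@idfun M) 0 = 0.
      by rewrite -(subrr 0) tensor_free_mapB subrr.
    by rewrite !free_eval0.
  - by rewrite tensor_free_mapB !free_evalB Es Ew.
  - by rewrite tensor_free_mapU !free_evalU.
apply: lP; have [h1 h2 h3] := psi_on.
have lT m : lspan l m -> T m.
  by apply: lspan_sub => y yl; rewrite mem_cat yl.
by split=> *; [apply: h1|apply: h2|apply: h3]; apply: lT.
Qed.
End Flatness.

Lemma flat_of_fg_projective (R : pzRingType) (M : lmodType R) :
    (forall (S : lmodType R) (sigma : {linear S -> M}),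
       injective sigma -> finitely_generated S -> projective_module S) ->
  flat M.
Proof.
move=> fgproj A B C f g fg; have [D cogD] := exists_cogenerator.
split; first exact: (tensor_id_injective cogD fg fgproj).
  exact: (tensor_id_exact cogD fg).
exact: (tensor_id_surjective fg).
Qed.

(** * The theorem *)

(** If R is the sum of R a and T and 1 = x a + z, then a - a x a = a z lies in
    both summands. *)
Lemma semisimple_von_neumann_regular (R : pzRingType) :
  semisimple_ring R -> von_neumann_regular R.
Proof.
move=> ss a.
have [T [cT dT sT]] := ss _ (submod_mem_closed (submodule_line (a : R^o))).
have [_ [z [/asboolP[x ->] Tz one]]] := sT 1.
have az : a - a * x * a = a * z.
  by rewrite -{1}[a]mulr1 one -mulrA -mulrBr addrC addKr.
exists x; apply/esym/eqP; rewrite -subr_eq0; apply/eqP/dT.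
  by apply/asboolP; exists (1 - a * x); rewrite scalerBl scale1r.
by rewrite az; apply: (submoduleZ (S := fun y : R^o => y \in T)).
Qed.

(** A singular module has no nonzero map to the nonsingular R^++. *)
Lemma singular_injective (R : pzRingType) :
    ~ von_neumann_regular R -> left_noetherian R -> left_nonsingular R ->
    (forall M : lmodType R,
       pure_injective M -> injective_module M \/ pi_indigent M) ->
  forall N : lmodType R, (forall x : N, singular x) -> injective_module N.
Proof.
move=> nvn noeth nonsing dichotomy N singN; have [D cogD] := exists_cogenerator.
have [|[_ ind]] := dichotomy _ (@char_pure_injective R (regular_char R D) D cogD).
  by move/(bidual_not_injective cogD noeth nonsing nvn).
apply: (absolutely_pure_injective cogD noeth); apply/ind => K i f _.
exists \0 => x; apply/esym/(bidual_nonsingular cogD noeth nonsing).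
exact: singular_im.
Qed.

Theorem lemma16 (R : pzRingType) :
  ~ von_neumann_regular R ->
  left_noetherian R ->
  left_nonsingular R ->
  (forall M : lmodType R,
      pure_injective M -> injective_module M \/ pi_indigent M) ->
  (forall M : lmodType R, ~ flat M -> i_test M) /\ left_n_saturated R.
Proof.
move=> nvn noeth nonsing dichotomy.
have fg_test := fg_nonprojective_i_test noeth dichotomy.
have singI := singular_injective nvn noeth nonsing dichotomy.
split=> [M nflat|].
  apply: contrapT => ntest; apply: nflat; apply: flat_of_fg_projective.
  move=> S sigma sigi fgS; apply: contrapT => nproj; apply: ntest.
  exact: (i_test_of_submodule singI sigi (fg_test S fgS nproj)).
split; last exact: fg_test.
by move=> /semisimple_von_neumann_regular.
Qed.
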